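(* Let $\beta>1$ and let $G$ be a connected plane 4-regular graph with $n$ vertices, with the black/white face coloring, black-face graph $H^*=(\mathcal{B},E^* )$ and edge weights $\beta_e$ as in the context. Then the worm process $P$ on $H^*$ with edge weights $\beta_e$ (which is the worm process for the planar four-vertex model $Z_{4V}(G;\beta,1)$ under the canonical labeling) has mixing time $$\tau_\varepsilon(P)\le 4n^7\left(\frac{\ln(2\varepsilon^{-1})}{n}+\ln\frac{2(\beta_{\min}+1)}{\beta_{\min}-1}\right),$$ where $\beta_{\min}=\min_{e\in E^*}\beta_e$.
   Context: Planar four-vertex model under canonical labeling. Let $G=(V,E)$ be a connected plane 4-regular graph, $n=|V|$. Its faces admit a proper 2-coloring (adjacent faces get different colors) by black and white with the outer face white; around each vertex the four corners alternate black, white, black, white. The model sums over orientations of $E$ such that at every vertex, for each of its two black corners, of the two edges bounding that corner one points into and one out of the vertex; then the boundary of each black face is a directed closed walk, clockwise or counterclockwise. The weight of such an orientation is $\beta^{N}$, where $N$ is the number of vertices whose two black corners lie in black faces (possibly the same face) with the same rotational direction; $Z_{4V}(G;\beta,1)$ is the sum of these weights. Assigning to each black face $0$ or $1$ according to its direction, this equals $\sum_{\sigma:\mathcal{B}\to\{0,1\}}\prod_{\{u,v\}\in E^*}\beta_{uv}^{\mathbf{I}(\sigma(u)=\sigma(v))}$ up to the constant factor from vertices whose two black corners lie in the same face, where: $\mathcal{B}$ is the set of black faces, $k=|\mathcal{B}|$; for distinct $F_1,F_2\in\mathcal{B}$, $\{F_1,F_2\}\in E^*$ iff some vertex of $G$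 has its two black corners in $F_1$ and $F_2$, and $\beta_{F_1F_2}=\beta^{r}$ with $r$ the number of such vertices. Worm process on $H^*=(\mathcal{B},E^* )$ with $m:=k$ vertices: $x_e=(\beta_e-1)/(\beta_e+1)$; $\Omega_j$ is the set of $S\subseteq E^*$ with exactly $j$ odd-degree vertices in $(\mathcal{B},S)$, $\partial S$ that set; state space $\Omega_0\cup\Omega_2$; $d(u)$ the degree of $u$ in $H^*$. For $\{u,v\}\in E^*$, with $A\oplus uv$ the symmetric difference of $A$ and $\{\{u,v\}\}$: $P(A,A\oplus uv)=x_{uv}^{\mathbf{I}(uv\notin A)}\frac1{2m}\big(\frac1{d(u)}+\frac1{d(v)}\big)$ if $A\in\Omega_0$; $=x_{uv}^{\mathbf{I}(uv\notin A)}\frac14\big(\frac1{d(u)}+\frac1{d(v)}\big)$ if $A\oplus uv\in\Omega_0$; $=\min\!\big(1,\frac{d(u)}{d(v)}x_{uv}^{\mathbf{I}(uv\notin A)-\mathbf{I}(uv\in A)}\big)\frac1{4d(u)}$ if $A,A\oplus uv\in\Omega_2$ and $u\in\partial A$; other off-diagonal entries $0$, diagonal entries $1$ minus the rest of the row. Stationary distribution $\pi(S)\propto\xi(S)\prod_{e\in S}x_e$, $\xi=m$ on $\Omega_0$, $2$ on $\Omega_2$. Mixing time: $\tau_\varepsilon(P)=\min\{t:\max_{x}\|P^t(x,\cdot)-\pi\|_{\mathrm{TV}}\le\varepsilon\}$, $\|\mu-\nu\|_{\mathrm{TV}}=\frac12\sum_x|\mu(x)-\nu(x)|$. *)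

(* Defs.v *)
From HB Require Import structures.
From mathcomp Require Import all_boot all_order all_algebra fingroup perm.
From mathcomp Require Import reals exp.
Set Implicit Arguments. Unset Strict Implicit. Unset Printing Implicit Defensive.
Import Order.TTheory GRing.Theory Num.Theory.
Local Open Scope ring_scope.

(* A plane graph is encoded as a combinatorial map on a finite set of darts  *)
(* (half-edges) D:                                                           *)
(*   alpha : the edge involution (dart -> opposite dart of the same edge),   *)
(*   sigma : the rotation of darts around their vertex (counterclockwise).   *)
(* Vertices = sigma-orbits, edges = alpha-orbits, faces = phi-orbits with    *)
(* phi := alpha \o sigma.  A dart d also names the corner between d and      *)
(* sigma d at its vertex; that corner lies in the face (phi-orbit) of d.     *)
(* Each orbit is represented by its canonical root (froot).                  *)

Section Map.
Variables (D : finType) (alpha sigma : {perm D}).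

Definition phi (d : D) : D := alpha (sigma d).

Definition vertices : {set D} := [set v | froot sigma v == v].
Definition edges : {set D} := [set d | froot alpha d == d].
Definition faces : {set D} := [set d | froot phi d == d].

Definition face (d : D) : D := froot phi d.

Definition edge_involution : Prop :=
  (forall d, alpha d != d) /\ (forall d, alpha (alpha d) = d).

Definition map_connected : Prop :=
  forall d1 d2 : D, connect (fun a b => (b == sigma a) || (b == alpha a)) d1 d2.

(* genus 0 (Euler's formula V - E + F = 2 for a connected map): plane graph *)
Definition planar_map : Prop :=
  (#|vertices| + #|faces| = #|edges| + 2)%N.

(* every vertex has degree 4 (loops counted twice) *)
Definition four_regular : Prop := forall d : D, fingraph.order sigma d = 4%N.

(* col d = true iff the face containing corner d is black.  [col] is a face  *)
(* colouring (constant along faces) which is proper: the two faces on either *)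
(* side of an edge get different colours; equivalently the corners around   *)
(* each vertex alternate black / white.                                       *)
Definition proper_face_coloring (col : D -> bool) : Prop :=
  (forall d, col (phi d) = col d) /\ (forall d, col (sigma d) = ~~ col d).

Variable col : D -> bool.

Definition black_faces : {set D} := [set F in faces | col F].

Definition rmult (e : {set D}) : nat :=
  #|[set v in vertices | [exists c1, exists c2,
       [&& fconnect sigma v c1, fconnect sigma v c2, col c1, col c2,
           face c1 \in e, face c2 \in e & face c1 != face c2]]]|.

Definition Estar : {set {set D}} :=
  [set e : {set D} | [&& e \subset black_faces, #|e| == 2%N & (0 < rmult e)%N]].

Definition degS (S : {set {set D}}) (u : D) : nat := #|[set e in S | u \in e]|.

Definition dH (u : D) : nat := degS Estar u.

Definition bd (S : {set {set D}}) : {set D} :=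
  [set u in black_faces | odd (degS S u)].

Definition Omega (j : nat) (S : {set {set D}}) : bool :=
  (S \subset Estar) && (#|bd S| == j).

Definition worm_state (S : {set {set D}}) : bool := Omega 0 S || Omega 2 S.

Definition symd (A : {set {set D}}) (e : {set D}) : {set {set D}} :=
  (A :\: [set e]) :|: ([set e] :\: A).

Variables (R : realType) (beta : R).

Definition beta_e (e : {set D}) : R := beta ^+ rmult e.
Definition x_e (e : {set D}) : R := (beta_e e - 1) / (beta_e e + 1).

Definition mB : nat := #|black_faces|.

Definition worm_q (A : {set {set D}}) (e : {set D}) : R :=
  let xind := if e \in A then 1 else x_e e in
  let sinv := \sum_(u in e) (dH u)%:R^-1 in
  if Omega 0 A then xind * (2 * mB%:R)^-1 * sinv
  else if Omega 0 (symd A e) then xind * 4^-1 * sinv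
  else if Omega 2 A && Omega 2 (symd A e) then
    \sum_(u in e | u \in bd A) \sum_(v in e | v != u)
       Num.min 1 ((dH u)%:R / (dH v)%:R *
                  (if e \in A then (x_e e)^-1 else x_e e)) / (4 * (dH u)%:R)
  else 0.

(* The transition matrix P (off-diagonal entries are the worm_q's, which   *)
(* correspond to distinct targets; the diagonal is 1 minus the row rest).  *)
Definition worm_P (A B : {set {set D}}) : R :=
  if B == A then 1 - \sum_(e in Estar) worm_q A e
  else \sum_(e in Estar | B == symd A e) worm_q A e.

Definition worm_weight (S : {set {set D}}) : R :=
  if worm_state S then
    (if Omega 0 S then mB%:R else 2) * \prod_(e in S) x_e e
  else 0.

Definition worm_pi (S : {set {set D}}) : R :=
  worm_weight S / \sum_(T : {set {set D}}) worm_weight T.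

(* beta_min = min_{e in E^*} beta_e  (convention: beta if E^* is empty) *)
Definition beta_min : R :=
  if [pick e in Estar] is Some e0 then \big[Num.min/beta_e e0]_(e in Estar) beta_e e
  else beta.

End Map.

Section Chains.
Variables (R : realType) (S : finType).

Definition step (P : S -> S -> R) (mu : S -> R) : S -> R :=
  fun y => \sum_x mu x * P x y.

Definition Pt (P : S -> S -> R) (t : nat) (x : S) : S -> R :=
  iter t (step P) (fun y => if y == x then 1 else 0).

Definition tv_dist (mu nu : S -> R) : R := 2^-1 * \sum_y `|mu y - nu y|.

Definition mixing_time_le (P : S -> S -> R) (pi : S -> R) (states : pred S)
    (eps T : R) : Prop :=
  exists t : nat, t%:R <= T /\
    forall x, states x -> tv_dist (Pt P t x) pi <= eps.

End Chains.

(* Main.v *)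
(* Spectral-gap proof by canonical paths. Writing I + F for the symmetric
   difference, a state I and an even subgraph F are joined by flipping the edges
   of S = I + F one at a time, in an order depending on S only and such that the
   part of S still to be flipped always has 0 or 2 odd vertices. At the step
   that flips e in the state T, the weight of the pair factors as
     w(I) w(F) = w(T u {e}) w(S + (T u {e})),
   and summing the last factor over S, with boundary Y, gives at most the weight
   of all even subgraphs, since Ising correlations are at most 1. Hence at most
   k^2 units of flow cross an edge, and the variance is at most
   4 |E*|^2 k^2 times the Dirichlet form, with |E*| <= n and k <= 2n. Laziness
   turns this Poincare inequality into geometric decay of the L2 distance. *)
Require Import Defs.
From HB Require Import structures.
From mathcomp Require Import all_boot all_order all_algebra fingroup perm.
From mathcomp Require Import reals sequences exp.
From mathcomp Require Import ring lra.
Set Implicit Arguments.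
Unset Strict Implicit.
Unset Printing Implicit Defensive.
Import Order.TTheory GRing.Theory Num.Theory.
Local Open Scope ring_scope.

(** * Lazy reversible chains: from a Poincare inequality to decay in total variation *)

Section ReversibleChain.
Variables (R : realType) (S : finType) (P : S -> S -> R) (pi : S -> R).
Hypothesis P_ge0 : forall x y, x != y -> 0 <= P x y.
Hypothesis P_lazy : forall x, 2^-1 <= P x x.
Hypothesis P_sum1 : forall x, \sum_y P x y = 1.
Hypothesis P_rev : forall x y, pi x * P x y = pi y * P y x.
Hypothesis pi_ge0 : forall x, 0 <= pi x.

Definition inner (f g : S -> R) : R := \sum_x pi x * (f x * g x).
Definition apply_kernel (f : S -> R) (x : S) : R := \sum_y P x y * f y.
Definition energy (f : S -> R) : R :=
  \sum_x \sum_y pi x * P x y * (f x - f y) ^+ 2.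

Local Notation K := apply_kernel.

Lemma innerC f g : inner f g = inner g f.
Proof. by apply: eq_bigr => x _; rewrite [f x * _]mulrC. Qed.

Lemma inner_lin f g h c :
  inner f (fun x => g x - c * h x) = inner f g - c * inner f h.
Proof.
rewrite /inner mulr_sumr -sumrB; apply: eq_bigr => x _; ring.
Qed.

Lemma kernel_lin g h c : K (fun x => g x - c * h x) =1 (fun x => K g x - c * K h x).
Proof.
by move=> x; rewrite /K mulr_sumr -sumrB; apply: eq_bigr => y _; ring.
Qed.

Lemma eq_inner f g g' : g =1 g' -> inner f g = inner f g'.
Proof. by move=> e; apply: eq_bigr => x _; rewrite e. Qed.

Lemma inner_kernelE f g : inner f (K g) = \sum_x \sum_y pi x * P x y * (f x * g y).
Proof.
apply: eq_bigr => x _; rewrite /K !mulr_sumr; apply: eq_bigr => y _; ring.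
Qed.

Lemma inner_kernelC f g : inner f (K g) = inner (K f) g.
Proof.
rewrite [RHS]innerC !inner_kernelE exchange_big; apply: eq_bigr => x _.
by apply: eq_bigr => y _; rewrite P_rev [g x * _]mulrC.
Qed.

Lemma inner_diag f : inner f f = \sum_x \sum_y pi x * P x y * f x ^+ 2.
Proof.
apply: eq_bigr => x _; rewrite -mulr_suml -mulr_sumr P_sum1; ring.
Qed.

Lemma inner_diag' f : inner f f = \sum_x \sum_y pi x * P x y * f y ^+ 2.
Proof.
rewrite inner_diag exchange_big; apply: eq_bigr => x _.
by apply: eq_bigr => y _; rewrite P_rev.
Qed.

Lemma energyE f : energy f = 2 * (inner f f - inner f (K f)).
Proof.
have -> : 2 * (inner f f - inner f (K f)) =
  inner f f + inner f f - 2 * inner f (K f) by ring.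
rewrite {1}inner_diag {1}inner_diag' inner_kernelE mulr_sumr -big_split -sumrB.
apply: eq_bigr => x _; rewrite mulr_sumr -big_split -sumrB /=.
apply: eq_bigr => y _; ring.
Qed.

(** Off the diagonal, (a - b)^2 <= 2 a^2 + 2 b^2. On the diagonal the energy vanishes, while
    laziness makes the larger sum at least 2 pi(x) f(x)^2, which pays for the [2 * inner f f]
    subtracted in [sum4]. *)
Lemma inner_kernel_ge0 f : 0 <= inner f (K f).
Proof.
suff: energy f <= 2 * inner f f by rewrite energyE; lra.
have sum4 : 2 * inner f f = \sum_x \sum_y
    (pi x * P x y * (2 * f x ^+ 2 + 2 * f y ^+ 2)) - 2 * inner f f.
  have -> : \sum_x \sum_y (pi x * P x y * (2 * f x ^+ 2 + 2 * f y ^+ 2)) =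
    2 * inner f f + 2 * inner f f.
    rewrite {1}inner_diag inner_diag' !mulr_sumr -big_split; apply: eq_bigr => x _.
    by rewrite !mulr_sumr -big_split; apply: eq_bigr => y _ /=; ring.
  ring.
rewrite sum4 /energy /inner mulr_sumr -sumrB; apply: ler_sum => x _.
rewrite (bigD1 x) //= [X in _ <= X - _](bigD1 x) //=.
set A := \sum_(_ | _) _; set B := \sum_(_ | _) _.
have AB : A <= B.
  apply: ler_sum => y yx; apply: ler_wpM2l; last by have := sqr_ge0 (f x + f y); nra.
  by rewrite mulr_ge0 // P_ge0 // eq_sym.
have : 0 <= pi x * (f x ^+ 2) by rewrite mulr_ge0 // sqr_ge0.
have : pi x * (f x ^+ 2) <= 2 * P x x * (pi x * (f x ^+ 2)).
  by apply: ler_peMl; [rewrite mulr_ge0 ?sqr_ge0|have := P_lazy x; lra].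
rewrite subrr expr0n /= mulr0 add0r -[f x * f x]expr2.
have -> : pi x * P x x * (2 * f x ^+ 2 + 2 * f x ^+ 2) =
  2 * (2 * P x x * (pi x * f x ^+ 2)) by ring.
by lra.
Qed.

Hypothesis pi_sum1 : \sum_x pi x = 1.
Variable C : R.
Hypothesis C_gt1 : 1 < C.
(** [energy] runs over ordered pairs without the usual factor 1/2, so the right-hand side is C times
    the Dirichlet form and 1/C is a lower bound on the spectral gap. *)
Hypothesis poincare :
  forall f, inner f f - (\sum_x pi x * f x) ^+ 2 <= C / 2 * energy f.

Lemma mean_kernel f : \sum_x pi x * K f x = \sum_x pi x * f x.
Proof.
transitivity (inner (fun=> 1) (K f)); first by apply: eq_bigr => x _; rewrite mul1r.
rewrite inner_kernelC; apply: eq_bigr => x _; congr (_ * _).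
by rewrite /K; under eq_bigr do rewrite mulr1; rewrite P_sum1 mul1r.
Qed.

Lemma poincare0 f : \sum_x pi x * f x = 0 -> inner f (K f) <= (1 - C^-1) * inner f f.
Proof.
move=> f0; have := poincare f; rewrite f0 expr0n subr0 energyE => le.
have C0 : 0 < C by exact: lt_trans ltr01 C_gt1.
have {}le : inner f f <= C * (inner f f - inner f (K f)).
  apply: le_trans le _; rewrite le_eqVlt; apply/orP; left; apply/eqP; by field.
rewrite -(ler_pM2l C0).
have -> : C * ((1 - C^-1) * inner f f) = C * inner f f - (C * C^-1) * inner f f by ring.
rewrite mulfV ?gt_eqF //; rewrite mul1r mulrBr in le *; lra.
Qed.

(* Applying the Poincare inequality to both g and K g, together with
   positivity of the form <., K .> at K g - l g, gives the factor l = 1 - 1/C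
   per step; bounding K^2 directly would lose a factor 2 in the rate. *)
Lemma kernel_contraction g : \sum_x pi x * g x = 0 ->
  inner (K g) (K g) <= (1 - C^-1) ^+ 2 * inner g g.
Proof.
move=> g0; set l := 1 - C^-1.
have l0 : 0 < l by rewrite subr_gt0 invf_lt1 ?C_gt1 ?(lt_trans ltr01 C_gt1).
have h1 := poincare0 g0.
have h2 := poincare0 (etrans (mean_kernel g) g0).
rewrite -/l in h1 h2.
have := inner_kernel_ge0 (fun x => K g x - l * g x).
rewrite (eq_inner _ (kernel_lin _ _ _)) inner_lin.
rewrite [inner _ (K (K g))]innerC [inner _ (K g)]innerC !inner_lin.
rewrite [inner (K g) g]innerC [inner (K (K g)) g]innerC [inner (K (K g)) (K g)]innerC.
rewrite [inner g (K (K g))]inner_kernelC.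
set a := inner g (K g) in h1 *; set b := inner (K g) (K g) in h2 *.
set c := inner (K g) _ in h2 *.
move=> h3; have : l * b <= l * (l * a) by nra.
rewrite ler_pM2l // => h4; apply: (le_trans h4); rewrite expr2 -mulrA ler_pM2l //.
Qed.

(** The density of [Pt P t x] with respect to [pi]; by reversibility it evolves under K itself
    rather than under the adjoint. *)
Fixpoint density (x : S) (t : nat) : S -> R :=
  if t is t'.+1 then K (density x t') else fun y => (if y == x then 1 else 0) / pi x.

Lemma Pt_density x t y : 0 < pi x -> Pt P t x y = pi y * density x t y.
Proof.
move=> px; elim: t y => [|t IH] y /=.
  by case: eqP => [->|_]; rewrite ?mul0r ?mulr0 // mul1r mulfV ?gt_eqF.
rewrite /step [X in _ = _ * X]/K mulr_sumr; apply: eq_bigr => z _.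
rewrite -/(Pt P t x z) IH mulrA -P_rev; ring.
Qed.

(** The two claims go through the induction together, since the contraction applies to functions of
    mean zero. At time 0 the squared norm is 1 / pi(x) - 1. *)
Lemma density_norm x t : 0 < pi x ->
  inner (fun y => density x t y - 1) (fun y => density x t y - 1)
    <= (1 - C^-1) ^+ (2 * t) / pi x
  /\ \sum_y pi y * (density x t y - 1) = 0.
Proof.
move=> px; elim: t => [|t [IH1 IH2]].
  have m1 : \sum_y pi y * density x 0 y = 1.
    rewrite (bigD1 x) //= eqxx mul1r mulfV ?gt_eqF // big1 ?addr0 // => y /negbTE ->.
    by rewrite mul0r mulr0.
  split; last first.
    by under eq_bigr do rewrite mulrBr mulr1; rewrite sumrB m1 pi_sum1 subrr.
  rewrite muln0 expr0 mul1r.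
  have -> : inner (fun y => density x 0 y - 1) (fun y => density x 0 y - 1) =
     \sum_y pi y * (density x 0 y) ^+ 2 - 2 * (\sum_y pi y * density x 0 y) + \sum_y pi y.
    rewrite mulr_sumr -sumrB -big_split; apply: eq_bigr => y _ /=; ring.
  rewrite m1 pi_sum1 (bigD1 x) //= eqxx big1 => [|y /negbTE ->]; last first.
    by rewrite mul0r expr0n mulr0.
  rewrite mul1r addr0 expr2 mulrA mulfV ?gt_eqF // mul1r; lra.
set g := fun y => density x t y - 1 in IH1 IH2.
have E : (fun y => density x t.+1 y - 1) =1 K g.
  move=> y; rewrite /g /= /K; under [RHS]eq_bigr do rewrite mulrBr mulr1.
  by rewrite sumrB P_sum1.
split; last first.
  by under eq_bigr do rewrite E; rewrite mean_kernel.
rewrite (eq_inner _ E) innerC (eq_inner _ E).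
apply: (le_trans (kernel_contraction IH2)).
rewrite mulnS exprD -mulrA ler_wpM2l // sqr_ge0 //.
Qed.

Lemma tv_decay x t : 0 < pi x ->
  (2 * tv_dist (Pt P t x) pi) ^+ 2 * pi x <= (1 - C^-1) ^+ (2 * t).
Proof.
move=> px; have [le _] := density_norm t px.
rewrite -ler_pdivlMr //; apply: le_trans le.
rewrite /tv_dist mulrA mulfV ?pnatr_eq0 // mul1r.
set u := fun y => `|density x t y - 1|.
have -> : \sum_y `|Pt P t x y - pi y| = \sum_y pi y * u y.
  apply: eq_bigr => y _; rewrite Pt_density // -{2}[pi y]mulr1 -mulrBr normrM.
  by rewrite ger0_norm.
have -> : inner (fun y => density x t y - 1) (fun y => density x t y - 1) =
          \sum_y pi y * u y ^+ 2.
  by apply: eq_bigr => y _; rewrite /u real_normK ?num_real // expr2.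
set m := \sum_y pi y * u y.
have var c : \sum_y pi y * (u y - c) ^+ 2 = \sum_y pi y * u y ^+ 2 - 2 * c * m + c ^+ 2.
  have -> : c ^+ 2 = c ^+ 2 * \sum_y pi y by rewrite pi_sum1 mulr1.
  rewrite !mulr_sumr -sumrB -big_split.
  by apply: eq_bigr => y _ /=; ring.
(* Nonnegativity of the variance of u is the Cauchy-Schwarz inequality between the L1 and L2
   norms. *)
have : 0 <= \sum_y pi y * (u y - m) ^+ 2.
  by apply: sumr_ge0 => y _; rewrite mulr_ge0 ?sqr_ge0.
rewrite var; lra.
Qed.

End ReversibleChain.

(** * Subsets as a group under symmetric difference, and its characters *)

Section SymmetricDifference.
Variable T : finType.
Implicit Types A B X Y : {set T}.

Definition sdiff A B : {set T} := (A :\: B) :|: (B :\: A).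

Lemma in_sdiff A B x : (x \in sdiff A B) = (x \in A) (+) (x \in B).
Proof. by rewrite !inE; do 2!case: (x \in _). Qed.

Lemma sdiffC A B : sdiff A B = sdiff B A.
Proof. by apply/setP=> x; rewrite !in_sdiff addbC. Qed.

Lemma sdiffA A B X : sdiff A (sdiff B X) = sdiff (sdiff A B) X.
Proof. by apply/setP=> x; rewrite !in_sdiff addbA. Qed.

Lemma sdiff0 A : sdiff A set0 = A.
Proof. by apply/setP=> x; rewrite in_sdiff inE addbF. Qed.

Lemma sdiffK A B : sdiff A (sdiff A B) = B.
Proof. by apply/setP=> x; rewrite !in_sdiff addKb. Qed.

Lemma sdiffKr A B : sdiff (sdiff A B) B = A.
Proof. by apply/setP=> x; rewrite !in_sdiff addbK. Qed.

Lemma sdiff_injl B : injective (sdiff^~ B).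
Proof. by move=> A X /= e; rewrite -(sdiffKr A B) e sdiffKr. Qed.

Lemma sdiffv A : sdiff A A = set0.
Proof. by apply/setP=> x; rewrite in_sdiff inE addbb. Qed.

Lemma sdiff_eq0 A B : (sdiff A B == set0) = (A == B).
Proof.
apply/eqP/eqP => [e|->]; last exact: sdiffv.
by rewrite -[LHS]sdiff0 -e sdiffK.
Qed.

Lemma sdiff_sub A B X : A \subset X -> B \subset X -> sdiff A B \subset X.
Proof.
move=> /subsetP AX /subsetP BX; apply/subsetP => x; rewrite !inE.
by case/orP=> /andP[_]; [exact: AX | exact: BX].
Qed.

Lemma sdiff_subE A B X : B \subset X -> (sdiff A B \subset X) = (A \subset X).
Proof.
move=> BX; apply/idP/idP => h; last exact: sdiff_sub.
by rewrite -(sdiffKr A B) sdiff_sub.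
Qed.

Lemma sdiff_setD A B : B \subset A -> sdiff A B = A :\: B.
Proof.
move=> /subsetP BA; apply/setP => x; rewrite in_sdiff inE.
by case: (boolP (x \in B)) => [/BA ->|] //=; rewrite addbF.
Qed.

Lemma sdiff1 A x : x \in A -> sdiff A [set x] = A :\ x.
Proof. by move=> xA; rewrite sdiff_setD // sub1set. Qed.

Lemma sdiff1N A x : x \notin A -> sdiff A [set x] = x |: A.
Proof.
move=> xA; apply/setP => y; rewrite in_sdiff !inE addbC.
by case: (eqVneq y x) => [->|]; rewrite ?(negbTE xA).
Qed.

Lemma odd_card_sdiff A B : odd #|sdiff A B| = odd #|A| (+) odd #|B|.
Proof.
rewrite cardsU (_ : _ :&: _ = set0) ?cards0 ?subn0; last first.
  by apply/setP=> x; rewrite !inE; do 2!case: (x \in _).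
rewrite -(cardsID B A) -(cardsID A B) [B :&: A]setIC !oddD.
by do 3!case: (odd _).
Qed.

Lemma sdiff_setI A B X : sdiff A B :&: X = sdiff (A :&: X) (B :&: X).
Proof. by apply/setP=> x; rewrite !inE; do 3!case: (x \in _). Qed.

Variable R : realType.

(** With spin -1 on X and +1 off X, this is the product of the spins over Y: a Walsh character,
    symmetric in X and Y. *)
Definition chi X Y : R := (-1) ^+ #|Y :&: X|.

Lemma chi0 X : chi X set0 = 1.
Proof. by rewrite /chi set0I cards0. Qed.

Lemma chi_sdiff X A B : chi X (sdiff A B) = chi X A * chi X B.
Proof.
by rewrite /chi sdiff_setI -signr_odd odd_card_sdiff signr_addb !signr_odd.
Qed.

Lemma chi_le1 X Y : `|chi X Y| <= 1.
Proof. by rewrite /chi normrX normrN1 expr1n. Qed.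

Lemma chiC X Y : chi X Y = chi Y X.
Proof. by rewrite /chi setIC. Qed.

(** Toggling in X a fixed element y of Y is an involution that flips the sign, so for nonempty Y the
    sum equals its own negative. *)
Lemma sum_chi Y : \sum_X chi X Y = if Y == set0 then #|{set T}|%:R else 0.
Proof.
case: eqP => [->|/eqP/set0Pn[y yY]].
  under eq_bigr do rewrite chi0.
  by rewrite sumr_const cardT -cardE.
have inv : involutive (fun X => sdiff X [set y]) by move=> X; rewrite sdiffKr.
have: \sum_X chi X Y = - \sum_X chi X Y; last lra.
rewrite {1}(reindex_inj (inv_inj inv)) /= -sumrN; apply: eq_bigr => X _.
rewrite chiC chi_sdiff [chi Y X]chiC {2}/chi (setIidPl _) ?sub1set // cards1 expr1.
by rewrite mulrN1.
Qed.

End SymmetricDifference.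

Arguments chi {T R}.

(** * Boundaries of edge sets and the high-temperature expansion of Ising correlations *)

Section Boundary.
Variables (D : finType) (alpha sigma : {perm D}) (col : D -> bool).
Implicit Types (A S : {set {set D}}) (e : {set D}).
Local Notation Estar := (Estar alpha sigma col).
Local Notation bd := (bd alpha sigma col).

Lemma symdE A e : symd A e = sdiff A [set e].
Proof. by []. Qed.

Lemma bd_sdiff A S : bd (sdiff A S) = sdiff (bd A) (bd S).
Proof.
apply/setP => u; rewrite in_sdiff !inE -andb_addr; congr andb; rewrite /degS.
rewrite -odd_card_sdiff; congr odd; apply: eq_card => e.
by rewrite !inE; do 3!case: (_ \in _).
Qed.

Lemma bd0 : bd set0 = set0.
Proof.
apply/setP => u; rewrite !inE /degS (_ : [set _ in _ | _] = set0) ?cards0 ?andbF //.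
by apply/setP=> e; rewrite !inE.
Qed.

Lemma Estar_sub e : e \in Estar -> e \subset black_faces alpha sigma col.
Proof. by rewrite inE => /and3P[]. Qed.

Lemma Estar_card e : e \in Estar -> #|e| = 2%N.
Proof. by rewrite inE => /and3P[_ /eqP]. Qed.

Lemma bd1 e : e \in Estar -> bd [set e] = e.
Proof.
move=> eE; apply/setP => u; rewrite inE /degS.
have [ue|ue] := boolP (u \in e).
  rewrite (subsetP (Estar_sub eE)) // (_ : [set _ in _ | _] = [set e]) ?cards1 //.
  by apply/setP=> e'; rewrite !inE; case: eqP => [->|].
rewrite (_ : [set _ in _ | _] = set0) ?cards0 ?andbF //.
by apply/setP=> e'; rewrite !inE; case: eqP => [->|] //; rewrite (negbTE ue).
Qed.

Lemma bd_sub S : bd S \subset black_faces alpha sigma col.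
Proof. by apply/subsetP => u; rewrite inE => /andP[]. Qed.

Variables (R : realType) (x : {set D} -> R).
Hypothesis x_range : forall e, e \in Estar -> 0 <= x e <= 1.

Definition wt S : R := \prod_(e in S) x e.

Lemma wt_ge0 S : S \subset Estar -> 0 <= wt S.
Proof. by move=> /subsetP SE; apply: prodr_ge0 => e /SE/x_range/andP[]. Qed.

(** The spin of a vertex occurs once per incident edge of S, so it cancels at even degree and
    survives at odd degree. *)
Lemma prod_chi X S : S \subset Estar ->
  \prod_(e in S) chi X e = chi X (bd S) :> R.
Proof.
move: {2}#|S| (erefl #|S|) => m; elim: m S => [|m IH] S cS SE.
  by move/eqP: cS; rewrite cards_eq0 => /eqP ->; rewrite big_set0 bd0 chi0.
have /card_gt0P[e eS] : (0 < #|S|)%N by rewrite cS.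
rewrite (big_setD1 e) //= IH; first last.
- exact: subset_trans (subsetDl _ _) SE.
- by move: cS; rewrite (cardsD1 e) eS => -[].
by rewrite -sdiff1 // bd_sdiff bd1 ?(subsetP SE) // chi_sdiff mulrC -mulrA -expr2 sqrr_sign mulr1.
Qed.

Definition corr Y : R := \sum_(S : {set {set D}} | (S \subset Estar) && (bd S == Y)) wt S.

(* The even-subgraph (high-temperature) expansion of an Ising correlation:
   summing over spin configurations X shows that corr Y / corr set0 is the
   expectation of a +/-1 variable. *)
Lemma corrE Y : #|{set D}|%:R * corr Y =
  \sum_(X : {set D}) chi X Y * \prod_(e in Estar) (1 + x e * chi X e).
Proof.
transitivity (\sum_(X : {set D}) \sum_(S : {set {set D}} | S \subset Estar)
    wt S * (chi X (sdiff Y (bd S)) : R)).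
  rewrite exchange_big /= /corr big_mkcondr mulr_sumr; apply: eq_bigr => S _.
  rewrite -mulr_sumr sum_chi sdiff_eq0 [bd S == Y]eq_sym.
  by case: ifP; rewrite ?mulr0 // mulrC.
apply: eq_bigr => X _; rewrite big_mkcond /=.
(* Off [Estar] the factor is 0 + 1, so the product runs over a whole finite type and expands over
   all its subsets; those not inside [Estar] contribute 0. *)
transitivity (\prod_(e : {set D}) ((if e \in Estar then x e * chi X e else 0) + 1) * chi X Y).
  rewrite bigA_distr mulr_suml; apply: eq_bigr => S _.
  rewrite -(big_mkcond (mem S)) /=; case: ifP => [SE|/negbT/subsetPn[e eS eE]].
    rewrite chi_sdiff -prod_chi // mulrA mulrAC -big_split /=; congr (_ * _).
    by apply: eq_bigr => e eS; rewrite (subsetP SE).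
  by rewrite (big_setD1 e) //= (negbTE eE) !mul0r.
rewrite mulrC; congr (_ * _); rewrite [RHS]big_mkcond; apply: eq_bigr => e _.
by case: ifP => _; rewrite ?add0r // addrC.
Qed.

(** In spin form both sides carry the same weights, nonnegative because each factor 1 + x chi is,
    and a character is at most 1. *)
Lemma corr_le Y : corr Y <= corr set0.
Proof.
have N0 : 0 < #|{set D}|%:R :> R by rewrite ltr0n; apply/card_gt0P; exists set0.
rewrite -(ler_pM2l N0) !corrE; apply: ler_sum => X _; rewrite chi0.
apply: ler_wpM2r; last by have := @chi_le1 D R X Y; rewrite ler_norml => /andP[].
apply: prodr_ge0 => e /x_range/andP[x0 x1].
by have := @chi_le1 D R X e; rewrite ler_norml => /andP[c1 c2]; nra.
Qed.

Lemma corr0_ge1 : 1 <= corr set0.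
Proof.
rewrite /corr (bigD1 set0) /=; last by rewrite sub0set bd0 eqxx.
rewrite {1}/wt big_set0 lerDl; apply: sumr_ge0 => S /andP[/andP[SE _] _].
exact: wt_ge0.
Qed.

End Boundary.

(** * Removing edges one at a time while keeping 0 or 2 odd vertices *)

Section Peeling.
Variables (D : finType) (alpha sigma : {perm D}) (col : D -> bool).
Implicit Types (A S : {set {set D}}) (e : {set D}).
Local Notation Es := (Estar alpha sigma col).
Local Notation bd := (bd alpha sigma col).

Definition few_odd S := (#|bd S| == 0%N) || (#|bd S| == 2%N).

Lemma card_sdiff2 (T : finType) (X Y : {set T}) : #|X| = 2%N -> #|Y| = 2%N ->
  #|sdiff X Y| = ((2 - #|X :&: Y|) * 2)%N.
Proof.
move=> cX cY; rewrite cardsU (_ : _ :&: _ = set0) ?cards0 ?subn0; last first.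
  by apply/setP=> x; rewrite !inE; do 2!case: (x \in _).
by rewrite !cardsD [Y :&: X]setIC cX cY muln2 addnn.
Qed.

(** If no vertex is odd, any edge will do: its two ends become odd. If two are odd, an edge at one
    of them either moves that defect to its other end or removes both defects. *)
Lemma exists_peelable S : S \subset Es -> S != set0 -> few_odd S ->
  exists2 e, e \in S & few_odd (S :\ e).
Proof.
move=> SE S0 /orP[|/eqP c2].
  rewrite cards_eq0 => /eqP b0; have [e eS] := set0Pn _ S0; exists e => //.
  have eE := subsetP SE e eS.
  by rewrite /few_odd -sdiff1 // bd_sdiff b0 bd1 // sdiffC sdiff0 (Estar_card eE) // orbT.
have /card_gt0P[a aS] : (0 < #|bd S|)%N by rewrite c2.
have : odd (degS S a) by move: aS; rewrite inE => /andP[].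
case: (posnP (degS S a)) => [-> //|/card_gt0P[e]]; rewrite inE => /andP[eS ae] _.
exists e => //; have eE := subsetP SE e eS.
rewrite /few_odd -sdiff1 // bd_sdiff bd1 // card_sdiff2 ?(Estar_card eE) //.
have : (0 < #|bd S :&: e|)%N by apply/card_gt0P; exists a; rewrite inE aS.
have : (#|bd S :&: e| <= 2)%N by rewrite -c2 subset_leq_card // subsetIl.
by case: #|_| => [|[|[|]]].
Qed.

(* [before e] is the set of edges of S flipped earlier than e. *)
Definition peeling S (before : {set D} -> {set {set D}}) :=
  (forall e, e \in S -> [/\ before e \subset S, e \notin before e,
     few_odd (S :\: before e) & few_odd (S :\: (e |: before e))]) /\
  (forall (M : zmodType) (f : {set {set D}} -> M) A, f A - f (sdiff A S) =
     \sum_(e in S) (f (sdiff A (before e)) - f (sdiff (sdiff A (before e)) [set e]))).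

(** A peelable e0 comes first and the rest is ordered by induction. The telescoping identity is
    needed from every start A, because the induction hypothesis is used with the start shifted by
    e0. *)
Lemma exists_peeling S : S \subset Es -> few_odd S -> exists before, peeling S before.
Proof.
move: {2}#|S| (erefl #|S|) => m; elim: m S => [|m IH] S cS SE oS.
  move/eqP: cS; rewrite cards_eq0 => /eqP ->; exists (fun=> set0); split=> [e|M f A].
    by rewrite inE.
  by rewrite big_set0 sdiff0 subrr.
have S0 : S != set0 by rewrite -cards_eq0 cS.
have [e0 e0S oS'] := exists_peelable SE S0 oS.
have cS' : #|S :\ e0| = m by move: cS; rewrite (cardsD1 e0) e0S => -[].
have [b [b1 b2]] := IH _ cS' (subset_trans (subsetDl _ _) SE) oS'.
exists (fun e => if e == e0 then set0 else e0 |: b e); split=> [e eS|M f A].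
  case: eqVneq => [->|ne].
    by rewrite sub0set inE setD0 setU0.
  have [|bS eb o1 o2] := b1 e; first by rewrite !inE ne.
  split; rewrite ?inE ?negb_or ?ne //.
  - by rewrite subUset sub1set e0S (subset_trans bS) // subsetDl.
  - by rewrite -setDDl.
  - by rewrite setUCA -setDDl.
rewrite (big_setD1 e0) //= eqxx sdiff0.
have -> : f A - f (sdiff A S) = (f A - f (sdiff A [set e0])) +
   (f (sdiff A [set e0]) - f (sdiff (sdiff A [set e0]) (S :\ e0))).
  rewrite addrA subrK; congr (_ - f _).
  by rewrite -sdiff1 // [sdiff S _]sdiffC sdiffA sdiffKr.
congr (_ + _); rewrite b2; apply: eq_bigr => e; rewrite !inE => /andP[ne eS].
rewrite (negbTE ne).
have [|bS eb _ _] := b1 e; first by rewrite !inE ne.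
have e0b : e0 \notin b e by apply/negP => /(subsetP bS); rewrite !inE eqxx.
by rewrite -sdiffA [sdiff [set e0] _]sdiffC sdiff1N.
Qed.

(** The order is fixed once for each S, without reference to the start of the path; the start is
    then recovered from S, the current state and the edge being flipped. *)
Lemma peelings : exists before : {set {set D}} -> {set D} -> {set {set D}},
  forall S, S \subset Es -> few_odd S -> peeling S (before S).
Proof.
have [b bP] : exists b : {set {set D}} -> {ffun {set D} -> {set {set D}}},
    forall S, S \subset Es -> few_odd S -> peeling S (b S).
  apply: (@fin_all_exists _ (fun=> {ffun {set D} -> {set {set D}}})
    (fun S b => S \subset Es -> few_odd S -> peeling S b)) => S;
      have [SE|NE] := boolP (S \subset Es); last first.
    by exists [ffun=> set0].
  have [oS|NO] := boolP (few_odd S); last by exists [ffun=> set0].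
  have [b [b1 b2]] := exists_peeling SE oS; exists [ffun e => b e].
  move=> _ _; split=> [e eS|M f A]; first by rewrite ffunE; exact: b1.
  by rewrite b2; apply: eq_bigr => e _; rewrite ffunE.
by exists b.
Qed.

End Peeling.

(** * Probability flow of the worm process, its laziness and reversibility *)

Section WormChain.
Variables (D : finType) (alpha sigma : {perm D}) (col : D -> bool).
Variables (R : realType) (beta : R).
Hypothesis beta_gt1 : 1 < beta.
Implicit Types (A S : {set {set D}}) (e : {set D}).
Local Notation Es := (Estar alpha sigma col).
Local Notation bd := (bd alpha sigma col).
Local Notation Om := (Omega alpha sigma col).
Local Notation state := (worm_state alpha sigma col).
Local Notation dg := (dH alpha sigma col).
Local Notation k := (mB alpha sigma col).
Local Notation x := (x_e alpha sigma col beta).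
Local Notation q := (worm_q alpha sigma col beta).
Local Notation P := (worm_P alpha sigma col beta).
Local Notation weight := (worm_weight alpha sigma col beta).
Local Notation wt := (wt x).

Lemma beta_e_gt1 e : e \in Es -> 1 < beta_e alpha sigma col beta e.
Proof.
by rewrite inE => /and3P[_ _ r0]; rewrite /beta_e exprn_egt1 // -lt0n.
Qed.

Lemma x_range e : e \in Es -> 0 < x e < 1.
Proof.
move=> /beta_e_gt1 b1; have b0 : 0 < beta_e alpha sigma col beta e + 1 by lra.
by rewrite /x_e divr_gt0 ?subr_gt0 //= ltr_pdivrMr //; lra.
Qed.

Lemma x_range_le e : e \in Es -> 0 <= x e <= 1.
Proof. by move=> /x_range/andP[x0 x1]; rewrite !ltW. Qed.

Lemma wt_gt0 A : A \subset Es -> 0 < wt A.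
Proof. by move=> /subsetP AE; apply: prodr_gt0 => e /AE/x_range/andP[]. Qed.

Lemma wt_sdiff A e : e \in Es ->
  wt (sdiff A [set e]) = (if e \in A then (x e)^-1 else x e) * wt A.
Proof.
move=> eE; have /andP[x0 _] := x_range eE; case: ifP => [eA|/negbT eA].
  by rewrite sdiff1 // /wt [in RHS](big_setD1 e) //= mulKf ?gt_eqF.
by rewrite sdiff1N // /wt big_setU1.
Qed.

(** As x < 1, [e |: A] is the lighter of A and A + e, the two ends of a transition; its weight is
    the natural scale of the flow between them. *)
Lemma wt_setU1 A e : wt (e |: A) = (if e \in A then 1 else x e) * wt A.
Proof.
case: ifP => [eA|/negbT eA]; first by rewrite mul1r (setUidPr _) // sub1set.
by rewrite /wt big_setU1.
Qed.

Lemma setU1_sdiff A e : e |: sdiff A [set e] = e |: A.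
Proof. by apply/setP=> y; rewrite !inE; case: eqP; case: (y \in A). Qed.

Lemma state_sub A : state A -> A \subset Es.
Proof. by case/orP=> /andP[]. Qed.

Lemma stateE A : state A = (A \subset Es) && few_odd alpha sigma col A.
Proof. by rewrite /worm_state /Omega -andb_orr. Qed.

Lemma Omega0E A : Om 0 A = (A \subset Es) && (bd A == set0).
Proof. by rewrite /Omega cards_eq0. Qed.

Lemma dg_gt0 e u : e \in Es -> u \in e -> (0 < dg u)%N.
Proof. by move=> eE ue; apply/card_gt0P; exists e; rewrite inE eE. Qed.

Lemma sdiff1_sub A e : e \in Es -> (sdiff A [set e] \subset Es) = (A \subset Es).
Proof. by move=> eE; rewrite sdiff_subE ?sub1set. Qed.

Lemma Omega0_sdiff A e : e \in Es -> Om 0 A -> Om 2 (sdiff A [set e]).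
Proof.
move=> eE; rewrite Omega0E => /andP[AE /eqP b0].
by rewrite /Omega sdiff1_sub // AE bd_sdiff b0 bd1 // sdiffC sdiff0 (Estar_card eE).
Qed.

Lemma Omega02 A : Om 0 A -> Om 2 A = false.
Proof. by rewrite /Omega => /andP[_ /eqP ->]; rewrite andbF. Qed.

(** Two 2-element sets have a 2-element symmetric difference only if they share exactly one point:
    the flip moves one odd vertex along e, from u to v. *)
Lemma Omega2_sdiff A e : e \in Es -> Om 2 A -> Om 2 (sdiff A [set e]) ->
  exists u v, [/\ u != v, e = [set u; v],
    forall w, (w \in e) && (w \in bd A) = (w == u) &
    forall w, (w \in e) && (w \in bd (sdiff A [set e])) = (w == v)].
Proof.
move=> eE /andP[_ /eqP c2] /andP[_]; rewrite bd_sdiff bd1 // => /eqP c2'.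
have ce := Estar_card eE.
have /eqP/cards1P[u uP] : #|bd A :&: e| = 1%N.
  by move: c2'; rewrite card_sdiff2 //; case: #|_| => [|[|[|]]].
have /eqP/cards1P[v vP] : #|e :\: bd A| = 1%N.
  by rewrite cardsD setIC uP ce cards1.
have uP' w : (w \in e) && (w \in bd A) = (w == u).
  by rewrite andbC -in_setI uP inE.
have vP' w : (w \in e) && (w \notin bd A) = (w == v).
  by rewrite andbC -in_setD vP inE.
exists u, v; split=> //.
- have /andP[_ ub] : (u \in e) && (u \in bd A) by rewrite uP'.
  by have := vP' u; rewrite ub andbF => <-.
- by apply/setP => w; rewrite !inE -uP' -vP'; case: (w \in e); case: (w \in bd A).
- by move=> w; rewrite in_sdiff -vP'; case: (w \in e); case: (w \in bd A).
Qed.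

(** The factors k and 2 of the stationary weight cancel the 1/(2k) and 1/4 of the two kinds of move
    down to 1/2. The value is the same from A and from A + e. *)
Lemma flow_Omega0 A e : e \in Es -> (0 < k)%N -> Om 0 A || Om 0 (sdiff A [set e]) ->
  weight A * q A e = wt (e |: A) / 2 * \sum_(u in e) (dg u)%:R^-1.
Proof.
move=> eE k0; have kn : k%:R != 0 :> R by rewrite pnatr_eq0 -lt0n.
rewrite /worm_weight /worm_q /worm_state symdE wt_setU1 -/(wt A).
have [A0 _|A0 /= A1] := boolP (Om 0 A); first by rewrite /=;
  move: (\sum_(u in e) _) (if _ then _ else _) (wt A) => t c w; field.
have A2 : Om 2 A by rewrite -(sdiffKr A [set e]) Omega0_sdiff.
by rewrite A1 A2; move: (\sum_(u in e) _) (if _ then _ else _) (wt A) => t c w; field.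
Qed.

(** Metropolis form: multiplying the acceptance minimum by the weight of A over d(u) makes it
    symmetric in the two ends, each taken with the degree of its own odd vertex on e. *)
Lemma flow_Omega2 A e : e \in Es -> Om 2 A -> Om 2 (sdiff A [set e]) ->
  exists u v, [/\ e = [set u; v], weight A * q A e =
       2^-1 * Num.min (wt A / (dg u)%:R) (wt (sdiff A [set e]) / (dg v)%:R) &
     weight (sdiff A [set e]) * q (sdiff A [set e]) e =
       2^-1 * Num.min (wt A / (dg u)%:R) (wt (sdiff A [set e]) / (dg v)%:R)].
Proof.
move=> eE A2 B2; have [u [v [uv ee uP vP]]] := Omega2_sdiff eE A2 B2.
have NA0 : ~~ Om 0 A by apply: contraL A2 => /Omega02 ->.
have NB0 : ~~ Om 0 (sdiff A [set e]) by apply: contraL B2 => /Omega02 ->.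
(* Stated for arbitrary data, to be used from A and, with u and v exchanged, from A + e. *)
have gen A' u' v' : Om 2 A' -> Om 2 (sdiff A' [set e]) ->
   ~~ Om 0 A' -> ~~ Om 0 (sdiff A' [set e]) -> u' != v' -> e = [set u'; v'] ->
   (forall w, (w \in e) && (w \in bd A') = (w == u')) -> weight A' * q A' e =
       2^-1 * Num.min (wt A' / (dg u')%:R) (wt (sdiff A' [set e]) / (dg v')%:R).
  move=> {A2 B2 NA0 NB0 ee uP vP uv u v A} A2 B2 NA0 NB0 uv ee uP.
  rewrite /worm_weight /worm_q /worm_state symdE A2 B2 (negbTE NA0) (negbTE NB0) /=.
  rewrite (eq_bigl _ _ uP) big_pred1_eq (big_pred1 v'); last first.
    move=> w; rewrite ee !inE; case: eqVneq => [->|] /=; rewrite ?andbT ?(negbTE uv) //.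
  have ue : u' \in e by rewrite ee !inE eqxx.
  have ve : v' \in e by rewrite ee !inE eqxx orbT.
  have du : 0 < (dg u')%:R :> R by rewrite ltr0n (@dg_gt0 e).
  have dv : 0 < (dg v')%:R :> R by rewrite ltr0n (@dg_gt0 e).
  rewrite -/(wt A') wt_sdiff //; set r := (if _ then _ else _).
  have w0 : 0 < wt A' by apply: wt_gt0; case/andP: A2.
  transitivity (2^-1 * (wt A' / (dg u')%:R * Num.min 1 ((dg u')%:R / (dg v')%:R * r))).
    by field; rewrite !gt_eqF.
  rewrite minr_pMr ?divr_ge0 ?ltW // mulr1; congr (_ * Num.min _ _).
  by field; rewrite !gt_eqF.
exists u, v; split=> //; first exact: gen.
have := gen (sdiff A [set e]) v u; rewrite sdiffKr [Num.min (_ / (dg v)%:R) _]minC.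
by apply=> //; [rewrite eq_sym | rewrite setUC].
Qed.

Lemma flow_out A e : e \in Es -> ~~ (state A && state (sdiff A [set e])) ->
  weight A * q A e = 0.
Proof.
move=> eE; rewrite /worm_weight /worm_q symdE.
have [SA /= NB|_ _] := boolP (state A); last by rewrite mul0r.
move: NB; rewrite negb_or => /andP[NB0 NB2].
have [A0|NA0] := boolP (Om 0 A); first by rewrite Omega0_sdiff in NB2.
by rewrite (negbTE NB0) (negbTE NB2) andbF mulr0.
Qed.

Lemma flow_sym A e : e \in Es -> (0 < k)%N ->
  weight A * q A e = weight (sdiff A [set e]) * q (sdiff A [set e]) e.
Proof.
move=> eE k0; have [/andP[SA SB]|N] := boolP (state A && state (sdiff A [set e])); last first.
  by rewrite flow_out // [RHS]flow_out // sdiffKr andbC.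
have [O0|] := boolP (Om 0 A || Om 0 (sdiff A [set e])).
  by rewrite !flow_Omega0 ?setU1_sdiff // sdiffKr orbC.
rewrite negb_or => /andP[A0 B0]; move: SA SB; rewrite /worm_state (negbTE A0) (negbTE B0) /=.
by move=> A2 B2; have [u [v [_ -> ->]]] := flow_Omega2 eE A2 B2.
Qed.

(** Both kinds of move dominate the lighter end: the two inverse degrees sum to at least 2 / Delta,
    and each entry of the Metropolis minimum is at least [wt (e |: A)] over Delta. *)
Lemma flow_lower A e (Delta : nat) : e \in Es -> (0 < k)%N ->
  (forall u, (dg u <= Delta)%N) -> state A -> state (sdiff A [set e]) ->
  wt (e |: A) <= 2 * Delta%:R * (weight A * q A e).
Proof.
move=> eE k0 dD SA SB.
have ce : #|e| = 2%N by exact: Estar_card eE.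
have dgV u : u \in e -> 1 <= Delta%:R / (dg u)%:R :> R.
  by move=> ue; rewrite ler_pdivlMr ?ltr0n ?(@dg_gt0 e) // mul1r ler_nat.
have wU : 0 < wt (e |: A) by apply: wt_gt0; rewrite subUset sub1set eE state_sub.
have [O0|] := boolP (Om 0 A || Om 0 (sdiff A [set e])).
  rewrite flow_Omega0 //.
  have : 2 <= Delta%:R * \sum_(u in e) (dg u)%:R^-1 :> R.
    by rewrite mulr_sumr -ce -sumr_const; apply: ler_sum => u /dgV.
  set t := \sum_(u in e) _ => h; have -> : 2 * Delta%:R * (wt (e |: A) / 2 * t) =
    wt (e |: A) * (Delta%:R * t) by field.
  by rewrite ler_peMr ?ltW //; lra.
rewrite negb_or => /andP[A0 B0]; move: (SA) (SB).
rewrite /worm_state (negbTE A0) (negbTE B0) /=.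
move=> A2 B2; have [u [v [ee -> _]]] := flow_Omega2 eE A2 B2.
have ue : u \in e by rewrite ee !inE eqxx.
have ve : v \in e by rewrite ee !inE eqxx orbT.
have /andP[x0 x1] := x_range eE.
have wA : 0 < wt A by apply/wt_gt0/state_sub.
have wB : 0 < wt (sdiff A [set e]) by apply/wt_gt0/state_sub.
have UA : wt (e |: A) <= wt A.
  by rewrite wt_setU1; case: ifP => _; rewrite ?mul1r // ler_piMl ?ltW.
have UB : wt (e |: A) <= wt (sdiff A [set e]).
  by rewrite -setU1_sdiff wt_setU1; case: ifP => _; rewrite ?mul1r // ler_piMl ?ltW.
have -> m : 2 * Delta%:R * (2^-1 * m) = Delta%:R * m :> R by field.
rewrite minr_pMr ?ler0n // le_min.
rewrite !mulrA ![Delta%:R * _]mulrC -!mulrA.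
by apply/andP; split; [apply: le_trans UA _ | apply: le_trans UB _];
  rewrite ler_peMr ?dgV ?ltW.
Qed.

Lemma q_ge0 A e : e \in Es -> 0 <= q A e.
Proof.
move=> eE; have /andP[x0 x1] := x_range eE.
have s0 : 0 <= \sum_(u in e) (dg u)%:R^-1 :> R.
  by apply: sumr_ge0 => u _; rewrite invr_ge0 ler0n.
have xi0 : 0 <= (if e \in A then 1 else x e) by case: ifP; rewrite ?ltW.
rewrite /worm_q; case: ifP => _; first by rewrite !mulr_ge0 ?invr_ge0 ?mulr_ge0 ?ler0n.
case: ifP => _; first by rewrite !mulr_ge0 ?invr_ge0 ?ler0n.
case: ifP => // _; apply: sumr_ge0 => u _; apply: sumr_ge0 => v _.
rewrite divr_ge0 ?mulr_ge0 ?ler0n // le_min ler01 /=.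
by rewrite !mulr_ge0 ?invr_ge0 ?ler0n //; case: ifP; rewrite ?invr_ge0 ltW.
Qed.

Lemma sum_incident (u : D) : \sum_(e in Es | u \in e) (dg u)%:R^-1 <= 1 :> R.
Proof.
rewrite (eq_bigl (mem [set e in Es | u \in e])) => [|e]; last by rewrite !inE.
rewrite sumr_const -[#|_|]/(dg u) -(mulr_natl _^-1); case: (posnP (dg u)) => [->|d0].
  by rewrite mul0r ler01.
by rewrite mulfV ?pnatr_eq0 -?lt0n.
Qed.

(** Each vertex spreads at most 1 over its incident edges. From [Om 0] all k vertices count, giving
    k / (2k); from [Om 2] only the two odd ones do, giving 2 / 4. *)
Lemma sum_q A : \sum_(e in Es) q A e <= 2^-1.
Proof.
have incid (B : {set D}) : \sum_(e in Es) \sum_(u in e | u \in B) (dg u)%:R^-1 <= #|B|%:R :> R.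
  rewrite (exchange_big_dep (mem B)) /=; last by move=> e u _ /andP[].
  rewrite -sumr_const; apply: ler_sum => u uB.
  apply: le_trans (sum_incident u); rewrite le_eqVlt; apply/orP; left; apply/eqP.
  by apply: eq_bigl => e; rewrite uB andbT.
have [A0|NA0] := boolP (Om 0 A).
  (* Without black faces there is no edge and the sum is empty. *)
  have [k0|k0] := posnP k.
    rewrite big1 ?invr_ge0 ?ler0n // => e eE.
    have := Estar_sub eE; move: k0 => /eqP; rewrite /mB cards_eq0 => /eqP ->.
    by rewrite subset0 => /eqP e0; have := Estar_card eE; rewrite e0 cards0.
  have kp : 0 < k%:R :> R by rewrite ltr0n.
  apply: (@le_trans _ _ ((2 * k%:R)^-1 *
    \sum_(e in Es) \sum_(u in e | u \in black_faces alpha sigma col) (dg u)%:R^-1)).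
    rewrite mulr_sumr; apply: ler_sum => e eE; rewrite /worm_q A0.
    rewrite (eq_bigl (fun u => (u \in e) && (u \in black_faces alpha sigma col))); last first.
      move=> u; case: (boolP (u \in e)) => //= ue.
      by rewrite (subsetP (Estar_sub eE)).
    apply: ler_wpM2r; first by apply: sumr_ge0 => u _; rewrite invr_ge0 ler0n.
    rewrite -[leRHS]mul1r ler_wpM2r ?invr_ge0 ?mulr_ge0 ?ler0n //.
    by case: ifP => _ //; have /andP[_ /ltW] := x_range eE.
  rewrite invfM -mulrA -[leRHS]mulr1 ler_pM2l ?invr_gt0 ?ltr0n //.
  by rewrite ler_pdivrMl // mulr1 incid.
have [A2|NA2] := boolP (Om 2 A); last first.
  rewrite big1 ?invr_ge0 ?ler0n // => e eE; rewrite /worm_q (negbTE NA0) (negbTE NA2) symdE /=.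
  have [B0|//] := boolP (Om 0 (sdiff A [set e])).
  by case/negP: NA2; rewrite -(sdiffKr A [set e]) Omega0_sdiff.
apply: (@le_trans _ _ (4^-1 * \sum_(e in Es) \sum_(u in e | u \in bd A) (dg u)%:R^-1)).
  rewrite mulr_sumr; apply: ler_sum => e eE; rewrite /worm_q (negbTE NA0) symdE.
  have /andP[x0 x1] := x_range eE.
  have [B0|NB0] := boolP (Om 0 (sdiff A [set e])).
    (* Reaching [Om 0] by flipping e forces the odd vertices to be the ends of e, so restricting to
       [bd A] loses nothing. *)
    have -> : bd A = e.
      move: B0; rewrite Omega0E bd_sdiff bd1 // sdiff_eq0 => /andP[_ /eqP //].
    under [in leRHS]eq_bigl do rewrite andbb.
    rewrite -mulrA; apply: ler_piMl; last by case: ifP => _ //; rewrite ltW.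
    by rewrite mulr_ge0 ?invr_ge0 ?ler0n //; apply: sumr_ge0 => u _; rewrite invr_ge0 ler0n.
  case: ifP => [_|_]; last first.
    by rewrite mulr_ge0 ?invr_ge0 ?ler0n //; apply: sumr_ge0 => u _; rewrite invr_ge0 ler0n.
  rewrite mulr_sumr; apply: ler_sum => u /andP[ue _].
  have /cards1P[v vP] : #|e :\ u| == 1%N.
    by have := Estar_card eE; rewrite (cardsD1 u) ue => -[/eqP].
  rewrite (big_pred1 v); last by move=> w; rewrite andbC -in_setD1 vP inE.
  have -> : 4^-1 / (dg u)%:R = (4 * (dg u)%:R)^-1 :> R by rewrite invfM.
  by apply: ler_piMl; rewrite ?ge_min ?lexx // invr_ge0 mulr_ge0 ?ler0n.
apply: (@le_trans _ _ (4^-1 * #|bd A|%:R)).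
  by rewrite ler_pM2l ?invr_gt0 ?ltr0n.
by have /andP[_ /eqP ->] := A2; lra.
Qed.

Lemma sdiff1_neq A e : (sdiff A [set e] == A) = false.
Proof.
apply/negP => /eqP/setP/(_ e); rewrite in_sdiff inE eqxx.
by case: (_ \in _).
Qed.

Lemma sum_worm_P A (h : {set {set D}} -> R) :
  \sum_(B | B != A) P A B * h B = \sum_(e in Es) q A e * h (sdiff A [set e]).
Proof.
transitivity (\sum_(B | B != A) \sum_(e in Es | B == sdiff A [set e]) q A e * h B).
  by apply: eq_bigr => B /negbTE BA; rewrite /worm_P BA mulr_suml.
rewrite (exchange_big_dep (mem Es)) /=; last by move=> B e _ /andP[].
apply: eq_bigr => e eE; rewrite (big_pred1 (sdiff A [set e])) // => B.
by rewrite eE /= andbC; case: eqP => [->|]; rewrite ?sdiff1_neq.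
Qed.

Lemma worm_P_ge0 A B : A != B -> 0 <= P A B.
Proof.
rewrite /worm_P eq_sym => /negbTE ->; apply: sumr_ge0 => e /andP[eE _].
exact: q_ge0.
Qed.

Lemma worm_P_lazy A : 2^-1 <= P A A.
Proof. by rewrite /worm_P eqxx; have := sum_q A; lra. Qed.

Lemma worm_P_sum1 A : \sum_B P A B = 1.
Proof.
rewrite (bigD1 A) //=; transitivity (P A A + \sum_(B | B != A) P A B * 1).
  by congr (_ + _); apply: eq_bigr => B _; rewrite mulr1.
rewrite sum_worm_P /worm_P eqxx; under [X in _ + X]eq_bigr do rewrite mulr1.
by rewrite subrK.
Qed.

Lemma weight_rev A B : (0 < k)%N -> weight A * P A B = weight B * P B A.
Proof.
move=> k0; rewrite /worm_P eq_sym; case: eqP => [->//|_]; rewrite !mulr_sumr.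
have sw e : (A == sdiff B [set e]) = (B == sdiff A [set e]).
  by apply/eqP/eqP => ->; rewrite sdiffKr.
under [RHS]eq_bigl do rewrite symdE sw.
by apply: eq_bigr => e /andP[eE /eqP ->]; rewrite flow_sym.
Qed.

Lemma weight_ge0 A : 0 <= weight A.
Proof.
rewrite /worm_weight; case: ifP => // SA.
by rewrite mulr_ge0 ?(ltW (wt_gt0 (state_sub SA))) //; case: ifP => _; rewrite ler0n.
Qed.

End WormChain.

(** * Variance and Cauchy-Schwarz inequalities *)

Section Variance.
Variables (R : realType) (T : finType) (pi : T -> R).
Hypothesis pi_ge0 : forall i, 0 <= pi i.
Hypothesis pi_sum1 : \sum_i pi i = 1.

Lemma expand_square (f : T -> R) c : \sum_i pi i * (f i - c) ^+ 2 =
  inner pi f f - 2 * c * (\sum_i pi i * f i) + c ^+ 2.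
Proof.
have -> : c ^+ 2 = c ^+ 2 * \sum_i pi i by rewrite pi_sum1 mulr1.
rewrite /inner !mulr_sumr -sumrB -big_split; apply: eq_bigr => i _ /=; ring.
Qed.

Lemma variance_le (f : T -> R) c :
  inner pi f f - (\sum_i pi i * f i) ^+ 2 <= \sum_i pi i * (f i - c) ^+ 2.
Proof. by rewrite expand_square; have := sqr_ge0 (c - \sum_i pi i * f i); nra. Qed.

Lemma inner_diag_ge (f : T -> R) : (\sum_i pi i * f i) ^+ 2 <= inner pi f f.
Proof.
have : 0 <= \sum_i pi i * (f i - \sum_i pi i * f i) ^+ 2.
  by apply: sumr_ge0 => i _; rewrite mulr_ge0 ?sqr_ge0.
rewrite expand_square; set m := \sum_i _; lra.
Qed.

End Variance.

(** The variance is at most the spread about the mean of f under [mu], and Jensen's inequality pulls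
    that mean out of the square. With [mu] carried by even subgraphs, canonical paths are needed to
    even targets only. *)
Lemma variance_le_two (R : realType) (T : finType) (pi mu : T -> R) (f : T -> R) :
  (forall i, 0 <= pi i) -> \sum_i pi i = 1 ->
  (forall i, 0 <= mu i) -> \sum_i mu i = 1 ->
  inner pi f f - (\sum_i pi i * f i) ^+ 2 <=
    \sum_i \sum_j pi i * mu j * (f i - f j) ^+ 2.
Proof.
move=> pi0 pi1 mu0 mu1; apply: (le_trans (variance_le pi1 f (\sum_j mu j * f j))).
apply: ler_sum => i _; under [leRHS]eq_bigr do rewrite -mulrA -opprB sqrrN.
rewrite -mulr_sumr ler_wpM2l // expand_square //.
have := inner_diag_ge mu0 mu1 f; nra.
Qed.

(** Expand the nonnegative sum of (g i - g j)^2 over all pairs. *)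
Lemma sqr_sum_le (R : realType) (T : finType) (A : {set T}) (g : T -> R) :
  (\sum_(i in A) g i) ^+ 2 <= #|A|%:R * \sum_(i in A) g i ^+ 2.
Proof.
have s1 : \sum_(i in A) \sum_(j in A) g i ^+ 2 = #|A|%:R * \sum_(i in A) g i ^+ 2.
  by rewrite mulr_sumr; apply: eq_bigr => i _; rewrite sumr_const -(mulr_natl (g i ^+ 2)).
have s2 : \sum_(i in A) \sum_(j in A) g j ^+ 2 = #|A|%:R * \sum_(i in A) g i ^+ 2.
  by rewrite exchange_big.
have : 0 <= \sum_(i in A) \sum_(j in A) (g i - g j) ^+ 2.
  by apply: sumr_ge0 => i _; apply: sumr_ge0 => j _; rewrite sqr_ge0.
have -> : \sum_(i in A) \sum_(j in A) (g i - g j) ^+ 2 =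
    \sum_(i in A) \sum_(j in A) g i ^+ 2 + \sum_(i in A) \sum_(j in A) g j ^+ 2
    - 2 * (\sum_(i in A) g i) ^+ 2.
  rewrite expr2 mulr_suml mulr_sumr -big_split -sumrB; apply: eq_bigr => i _ /=.
  rewrite !mulr_sumr -big_split -sumrB; apply: eq_bigr => j _ /=; ring.
rewrite s1 s2; lra.
Qed.

(** * Canonical paths and the Poincare inequality of the worm process *)

Section WormPoincare.
Variables (D : finType) (alpha sigma : {perm D}) (col : D -> bool).
Variables (R : realType) (beta : R).
Hypothesis beta_gt1 : 1 < beta.
Implicit Types (A S I F T U V : {set {set D}}) (e Y : {set D}).
Local Notation Es := (Estar alpha sigma col).
Local Notation bd := (bd alpha sigma col).
Local Notation Om := (Omega alpha sigma col).
Local Notation state := (worm_state alpha sigma col).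
Local Notation few := (few_odd alpha sigma col).
Local Notation dg := (dH alpha sigma col).
Local Notation k := (mB alpha sigma col).
Local Notation x := (x_e alpha sigma col beta).
Local Notation q := (worm_q alpha sigma col beta).
Local Notation P := (worm_P alpha sigma col beta).
Local Notation weight := (worm_weight alpha sigma col beta).
Local Notation pi := (worm_pi alpha sigma col beta).
Local Notation wt := (wt x).
Local Notation W0 := (corr alpha sigma col x set0).
Local Notation Z := (\sum_A weight A).
Hypothesis k_gt0 : (0 < k)%N.

Lemma state0 : state set0.
Proof. by rewrite /worm_state Omega0E sub0set bd0 eqxx. Qed.

Lemma Z_gt0 : 0 < Z.
Proof.
rewrite (bigD1 set0) //= ltr_pwDl //; last by apply: sumr_ge0 => A _; exact: weight_ge0.
rewrite /worm_weight state0 mulr_gt0 //; last by apply: wt_gt0; rewrite ?sub0set.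
by case: ifP; rewrite ltr0n.
Qed.

Lemma pi_ge0 A : 0 <= pi A.
Proof. by rewrite /worm_pi divr_ge0 ?weight_ge0 // ltW ?Z_gt0. Qed.

Lemma pi_sum1 : \sum_A pi A = 1.
Proof. by rewrite /worm_pi -mulr_suml mulfV // gt_eqF ?Z_gt0. Qed.

Lemma pi_rev A B : pi A * P A B = pi B * P B A.
Proof. by rewrite /worm_pi mulrAC weight_rev // mulrAC. Qed.

Lemma W0_gt0 : 0 < W0.
Proof. exact: lt_le_trans ltr01 (corr0_ge1 (x_range_le beta_gt1)). Qed.

(** The stationary law conditioned on having no odd vertex; the factor k is constant there and
    cancels. *)
Definition even_law F : R := if Om 0 F then wt F / W0 else 0.

Lemma even_law_ge0 F : 0 <= even_law F.
Proof.
rewrite /even_law; case: ifP => // /andP[FE _].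
by rewrite divr_ge0 ?(ltW W0_gt0) // ltW ?wt_gt0.
Qed.

Lemma even_law_sum1 : \sum_F even_law F = 1.
Proof.
rewrite /even_law -big_mkcond -mulr_suml /= (eq_bigl _ _ (Omega0E alpha sigma col)).
by rewrite mulfV // gt_eqF ?W0_gt0.
Qed.

Lemma wt_mul I F U V : (forall y, (y \in I) + (y \in F) = (y \in U) + (y \in V))%N ->
  wt I * wt F = wt U * wt V.
Proof.
move=> h; rewrite /wt; do 4!rewrite [\prod_(e in _) _]big_mkcond /=.
rewrite -!big_split /=; apply: eq_bigr => y _; have := h y.
by do 4!case: (y \in _); rewrite ?mulr1 ?mul1r.
Qed.

(** When I + S is even, I and S have the same boundary, so this is the factor k or 2 of the starting
    state I, read off from S alone. *)
Definition odd_factor S : R := if bd S == set0 then k%:R else 2.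

(** Substituting S + U for S gives the correlation with boundary Y + bd U, to which [corr_le]
    applies. *)
Lemma sum_shift_corr U Y : U \subset Es ->
  \sum_(S : {set {set D}} | (S \subset Es) && (bd S == Y)) wt (sdiff S U) <= W0.
Proof.
move=> UE; apply: le_trans (corr_le (x_range_le beta_gt1) (sdiff Y (bd U))).
rewrite /corr (reindex_inj (@sdiff_injl _ U)) /= le_eqVlt; apply/orP; left.
apply/eqP/eq_big => [S|S _]; last by rewrite sdiffKr.
by rewrite sdiff_subE // bd_sdiff -(inj_eq (@sdiff_injl _ (bd U))) sdiffKr.
Qed.

(** Split by boundary: the empty one contributes k, and each of the k(k-1)/2 pairs contributes 2, in
    total k + k(k-1) = k^2. *)
Lemma sum_odd_factor U : U \subset Es ->
  \sum_(S : {set {set D}} | (S \subset Es) && few S) odd_factor S * wt (sdiff S U)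
    <= (k ^ 2)%:R * W0.
Proof.
move=> UE; have W0g := W0_gt0.
rewrite (bigID (fun S => bd S == set0)) /=.
have b1 : \sum_(S : {set {set D}} | (S \subset Es) && few S && (bd S == set0))
    odd_factor S * wt (sdiff S U) <= k%:R * W0.
  rewrite (eq_bigl (fun S => (S \subset Es) && (bd S == set0))); last first.
    move=> S; rewrite -andbA /few_odd; case: (S \subset Es) => //=.
    by case: (eqVneq (bd S) set0) => [->|]; rewrite ?cards0 ?andbF.
  rewrite (eq_bigr (fun S => k%:R * wt (sdiff S U))); last first.
    by move=> S /andP[_ b0]; rewrite /odd_factor b0.
  by rewrite -mulr_sumr ler_wpM2l ?ler0n // sum_shift_corr.
pose Ys := [set Y : {set D} | (Y \subset black_faces alpha sigma col) & #|Y| == 2%N].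
have b2 : \sum_(S : {set {set D}} | (S \subset Es) && few S && (bd S != set0))
    odd_factor S * wt (sdiff S U) <= (k ^_ 2)%:R * W0.
  rewrite (eq_bigl (fun S => (S \subset Es) && (#|bd S| == 2%N))); last first.
    move=> S; rewrite -andbA /few_odd -cards_eq0; case: (S \subset Es) => //=.
    by case: #|_| => [|[|[|]]].
  rewrite (partition_big bd (mem Ys)) /=; last first.
    by move=> S /andP[_ c2]; rewrite inE bd_sub c2.
  rewrite -bin_ffact -(cards_draws (black_faces alpha sigma col) 2) -/Ys natrM -mulrA.
  rewrite mulr_natl -sumr_const; apply: ler_sum => Y; rewrite inE => /andP[_ /eqP c2].
  rewrite (eq_bigl (fun S => (S \subset Es) && (bd S == Y))); last first.
    move=> S; rewrite -andbA; case: (S \subset Es) => //=.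
    by case: (eqVneq (bd S) Y) => [->|]; rewrite ?andbF // c2.
  rewrite (eq_bigr (fun S => 2 * wt (sdiff S U))); last first.
    by move=> S /andP[_ /eqP b0]; rewrite /odd_factor b0 -cards_eq0 c2.
  by rewrite -mulr_sumr ler_wpM2l ?ler0n // sum_shift_corr.
apply: le_trans (lerD b1 b2) _; rewrite -mulrDl ler_wpM2r ?(ltW W0g) // -natrD ler_nat.
by rewrite ffactnS ffactn1 expnS expn1; case: (k) => // m; rewrite /= mulnS.
Qed.

Variable before : {set {set D}} -> {set D} -> {set {set D}}.
Hypothesis beforeP : forall S, S \subset Es -> few S ->
  peeling alpha sigma col S (before S).

Definition path_weight I S : R := pi I * even_law (sdiff I S).

Lemma path_weight_ge0 I S : 0 <= path_weight I S.
Proof. by rewrite mulr_ge0 ?pi_ge0 ?even_law_ge0. Qed.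

Lemma path_weight_out I S : ~~ (state I && Om 0 (sdiff I S)) -> path_weight I S = 0.
Proof.
rewrite negb_and /path_weight => /orP[/negbTE N|/negbTE N].
  by rewrite /worm_pi /worm_weight N !mul0r.
by rewrite /even_law N mulr0.
Qed.

Lemma path_ends I S : state I -> Om 0 (sdiff I S) ->
  [/\ S \subset Es, bd I = bd S & few S].
Proof.
rewrite stateE Omega0E => /andP[IE oI] /andP[FE].
rewrite bd_sdiff sdiff_eq0 => /eqP e; split=> //.
  by rewrite -(sdiffK I S) sdiff_sub.
by rewrite /few_odd -e.
Qed.

Lemma path_step I S e (T := sdiff I (before S e)) :
  state I -> Om 0 (sdiff I S) -> e \in S ->
  [/\ state T, state (sdiff T [set e]) &
   path_weight I S = odd_factor S * wt (sdiff S (e |: T)) * wt (e |: T) / (Z * W0)].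
Proof.
move=> SI F0 eS; have [SE bI oS] := path_ends SI F0.
have [/(_ e eS)[bS eb o1 o2] _] := beforeP SE oS.
have IE := state_sub SI; have bE := subset_trans bS SE.
have eE := subsetP SE e eS.
have TE : T \subset Es by rewrite sdiff_sub.
have bT : bd T = bd (S :\: before S e).
  by rewrite -sdiff_setD // !bd_sdiff bI.
have bT' : bd (sdiff T [set e]) = bd (S :\: (e |: before S e)).
  rewrite bd_sdiff bT -bd_sdiff sdiff1 ?inE ?eb // setDDl setUC //.
split.
- by rewrite stateE TE /few_odd bT.
- by rewrite stateE sdiff1_sub // TE /few_odd bT'.
rewrite /path_weight /even_law F0 /worm_pi /worm_weight SI.
have -> : (if Om 0 I then k%:R else 2) = odd_factor S.
  by rewrite Omega0E IE /odd_factor bI.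
(* Let F = I + S. On edges flipped before e, T agrees with F and S + T with I; on all others but e
   it is the other way round. The edge e lies in exactly one of I and F, and on the right only in
   the first set. *)
have E : wt I * wt (sdiff I S) = wt (e |: T) * wt (sdiff S (e |: T)).
  apply: wt_mul => y; rewrite !in_sdiff !in_setU1 /T !in_sdiff.
  case: (eqVneq y e) => [->|_] /=.
    by rewrite eS; case: (e \in I).
  case: (boolP (y \in before S e)) => [/(subsetP bS) ->|_];
  by case: (y \in I); case: (y \in S).
rewrite -!/(wt _); have Zg := Z_gt0; have Wg := W0_gt0.
transitivity (odd_factor S * (wt I * wt (sdiff I S)) / (Z * W0)).
  by field; rewrite !gt_eqF.
by rewrite E; field; rewrite !gt_eqF.
Qed.

Variable Delta : nat.
Hypothesis dg_le : forall u, (dg u <= Delta)%N.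

(* S determines I and F from T, so the flow through (T, e) is a sum over S. *)
Lemma congestion T e :
  \sum_(S : {set {set D}} | e \in S) path_weight (sdiff T (before S e)) S <=
  if e \in Es then 2 * Delta%:R * (k ^ 2)%:R * (pi T * q T e) else 0.
Proof.
have [/and3P[eE ST ST']|N] := boolP [&& e \in Es, state T & state (sdiff T [set e])]; last first.
  (* Outside the main case no canonical path of positive weight flips e in the state T. *)
  rewrite big1 => [|S eS].
    case: ifP => // eE; have pq0 := mulr_ge0 (pi_ge0 T) (q_ge0 beta_gt1 T eE).
    by rewrite mulr_ge0 // !mulr_ge0 ?ler0n.
  have [/andP[SI F0]|] := boolP (state (sdiff T (before S e)) &&
      Om 0 (sdiff (sdiff T (before S e)) S)); last exact: path_weight_out.
  have [] := path_step SI F0 eS; rewrite sdiffKr => ST ST' _.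
  have [SE _ _] := path_ends SI F0.
  by case/negP: N; rewrite ST ST' (subsetP SE).
rewrite eE; have Zg := Z_gt0; have Wg := W0_gt0.
have UE : e |: T \subset Es by rewrite subUset sub1set eE state_sub.
have Ug : 0 < wt (e |: T) by apply: wt_gt0.
(* The conditions that e lies in S and that the path has admissible ends are dropped, leaving every
   S with 0 or 2 odd vertices. *)
apply: (@le_trans _ _ (\sum_(S : {set {set D}} | (S \subset Es) && few S)
   odd_factor S * wt (sdiff S (e |: T)) * (wt (e |: T) / (Z * W0)))).
  rewrite big_mkcond [leRHS]big_mkcond; apply: ler_sum => S _.
  have r0 : 0 <= if (S \subset Es) && few S then
      odd_factor S * wt (sdiff S (e |: T)) * (wt (e |: T) / (Z * W0)) else 0.
    case: ifP => // /andP[SE _];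
      rewrite mulr_ge0 ?divr_ge0 ?mulr_ge0 ?(ltW Zg) ?(ltW Wg) ?(ltW Ug) //.
      by rewrite /odd_factor; case: ifP; rewrite ler0n.
    by rewrite ltW // wt_gt0 // sdiff_sub.
  case: ifP => // eS.
  have [/andP[SI F0]|/path_weight_out -> //] := boolP (state (sdiff T (before S e)) &&
      Om 0 (sdiff (sdiff T (before S e)) S)).
  have [SE _ oS] := path_ends SI F0; have [_ _ ->] := path_step SI F0 eS.
  by rewrite SE oS sdiffKr mulrA.
rewrite -mulr_suml; apply: (@le_trans _ _ ((k ^ 2)%:R * W0 * (wt (e |: T) / (Z * W0)))).
  by rewrite ler_wpM2r ?sum_odd_factor // divr_ge0 ?mulr_ge0 ?ltW.
have -> : (k ^ 2)%:R * W0 * (wt (e |: T) / (Z * W0)) = (k ^ 2)%:R / Z * wt (e |: T).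
  by field; rewrite !gt_eqF.
have -> : 2 * Delta%:R * (k ^ 2)%:R * (pi T * q T e) =
   (k ^ 2)%:R / Z * (2 * Delta%:R * (weight T * q T e)).
  by rewrite /worm_pi; field; rewrite gt_eqF.
by rewrite ler_wpM2l ?divr_ge0 ?ler0n ?(ltW Zg) // flow_lower.
Qed.

Lemma energy_flows f :
  energy P pi f = \sum_T \sum_(e in Es) pi T * q T e * (f T - f (sdiff T [set e])) ^+ 2.
Proof.
apply: eq_bigr => T _; rewrite (bigD1 T) //= subrr expr0n mulr0 add0r.
under eq_bigr do rewrite -mulrA; rewrite -mulr_sumr.
rewrite (sum_worm_P _ _ _ _ _ (fun B => (f T - f B) ^+ 2)) mulr_sumr.
by apply: eq_bigr => e _; rewrite mulrA.
Qed.

(** Cauchy-Schwarz along a path costs its length, at most |E*|; exchanging the sums then collects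
    the flow through each (T, e), which [congestion] bounds. *)
Lemma worm_poincare_with f :
  inner pi f f - (\sum_A pi A * f A) ^+ 2 <=
  #|Es|%:R * (2 * Delta%:R * (k ^ 2)%:R) * energy P pi f.
Proof.
apply: (le_trans (variance_le_two f pi_ge0 pi_sum1 even_law_ge0 even_law_sum1)).
pose g T e := (f T - f (sdiff T [set e])) ^+ 2.
have g0 T e : 0 <= g T e by rewrite sqr_ge0.
pose M : R := \sum_I \sum_(S : {set {set D}}) \sum_(e in S)
    #|Es|%:R * (path_weight I S * g (sdiff I (before S e)) e).
apply: (@le_trans _ _ M).
  apply: ler_sum => I _; rewrite (reindex_inj (can_inj (sdiffK I))) /=.
  apply: ler_sum => S _; rewrite -/(path_weight I S).
  have [/andP[SI F0]|/path_weight_out ->] := boolP (state I && Om 0 (sdiff I S)); last first.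
    by rewrite mul0r; apply: sumr_ge0 => e _; rewrite mul0r mulr0.
  have [SE _ oS] := path_ends SI F0; have [_ ->] := beforeP SE oS.
  under eq_bigr do rewrite mulrCA; rewrite -mulr_sumr ler_wpM2l ?path_weight_ge0 //.
  apply: (le_trans (sqr_sum_le _ _)); rewrite -mulr_sumr ler_wpM2r //.
    by apply: sumr_ge0 => e _; exact: g0.
  by rewrite ler_nat subset_leq_card.
rewrite energy_flows -mulrA mulr_sumr.
apply: (@le_trans _ _ (\sum_T #|Es|%:R * \sum_e (g T e *
   \sum_(S : {set {set D}} | e \in S) path_weight (sdiff T (before S e)) S))).
  rewrite le_eqVlt; apply/orP; left; apply/eqP; rewrite /M exchange_big /=.
  transitivity (\sum_(S : {set {set D}}) \sum_(e in S) \sum_T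
      #|Es|%:R * (path_weight (sdiff T (before S e)) S * g T e)).
    apply: eq_bigr => S _; rewrite exchange_big; apply: eq_bigr => e eS.
    (* For fixed S and e, the start I is replaced by the state T in which e is flipped. *)
    rewrite (reindex_inj (@sdiff_injl _ (before S e))) /=.
    by apply: eq_bigr => T _; rewrite sdiffKr.
  under [RHS]eq_bigr do rewrite mulr_sumr; rewrite [RHS]exchange_big /=.
  rewrite (exchange_big_dep predT) //=; apply: eq_bigr => e _.
  rewrite exchange_big; apply: eq_bigr => T _ /=; rewrite !mulr_sumr.
  by apply: eq_bigr => S _; congr (_ * _); rewrite mulrC.
rewrite mulr_sumr; apply: ler_sum => T _; rewrite ler_wpM2l ?ler0n //.
rewrite mulr_sumr [leRHS]big_mkcond; apply: ler_sum => e _.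
apply: le_trans (ler_wpM2l (g0 T e) (congestion T e)) _.
by case: ifP => _; rewrite ?mulr0 // mulrC -!mulrA.
Qed.

End WormPoincare.

(** * Counting black faces and edges of H* from the darts *)

Section FourRegularMap.
Variables (D : finType) (alpha sigma : {perm D}) (col : D -> bool).
Hypothesis fourR : four_regular sigma.
Hypothesis colP : proper_face_coloring alpha sigma col.
Local Notation Es := (Estar alpha sigma col).
Local Notation k := (mB alpha sigma col).
Local Notation n := #|vertices sigma|.

Lemma card_darts : #|D| = (n * 4)%N.
Proof.
rewrite -[#|D|](@fcard_order_set _ _ (@perm_inj _ sigma) 4 predT) //.
  by congr muln; apply: eq_card => v; rewrite !inE andbT.
by apply/subsetP => d _; rewrite inE fourR.
Qed.

(** [sigma] sends the black darts of O injectively to white darts of O. *)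
Lemma double_black (O : {set D}) : (forall d, d \in O -> sigma d \in O) ->
  (2 * #|[set d in O | col d]| <= #|O|)%N.
Proof.
move=> cl; rewrite -(cardsID [set d | col d] O) mul2n -addnn setIdE leq_add2l.
rewrite -(card_imset _ (@perm_inj _ sigma)); apply: subset_leq_card.
apply/subsetP => d /imsetP[c]; rewrite !inE => /andP[cO cc] ->.
by rewrite cl // (proj2 colP) cc.
Qed.

(** Of the 4n darts at most half are black, and each black face has its own black root dart. *)
Lemma card_black_faces_le : (k <= 2 * n)%N.
Proof.
have := @double_black setT (fun d _ => in_setT (sigma d)).
rewrite cardsT card_darts (_ : 4 = 2 * 2)%N // mulnCA leq_pmul2l // mulnC => h.
apply: leq_trans h; apply: subset_leq_card; apply/subsetP => d.
by rewrite !inE => /andP[].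
Qed.

Lemma phi_inj : injective (phi alpha sigma).
Proof. by move=> c d /perm_inj/perm_inj. Qed.

Lemma card_black_faces_gt0 : (0 < n)%N -> (0 < k)%N.
Proof.
case/card_gt0P => d0 _; have [d dB] : exists d, col d.
  by case: (boolP (col d0)) => [|h]; [exists d0 | exists (sigma d0); rewrite (proj2 colP)].
apply/card_gt0P; exists (froot (phi alpha sigma) d); rewrite !inE.
rewrite (root_root (fconnect_sym phi_inj)) eqxx /=.
have cl : fclosed (phi alpha sigma) [pred c | col c].
  by move=> a b /eqP <-; rewrite !inE (proj1 colP).
by have := closed_connect cl (connect_root (frel (phi alpha sigma)) d); rewrite !inE => <-.
Qed.

(** A vertex has at most two black corners, so it accounts for at most one pair of faces: [ends]
    sends any vertex witnessing e to e itself. *)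
Lemma card_Estar_le : (#|Es| <= n)%N.
Proof.
pose corners v := [set c in [set c | fconnect sigma v c] | col c].
pose ends v := [set face alpha sigma c | c in corners v].
have card_ends v : (#|ends v| <= 2)%N.
  apply: (leq_trans (leq_imset_card _ _)); rewrite -(leq_pmul2l (isT : 0 < 2)%N).
  apply: (leq_trans (double_black _)); last first.
    by rewrite cardsE -[#|_|]/(fingraph.order sigma v) fourR.
  by move=> d; rewrite !inE => vd; apply: connect_trans vd (fconnect1 _ _).
apply: leq_trans (leq_imset_card ends (vertices sigma)).
apply: subset_leq_card; apply/subsetP => e; rewrite inE => /and3P[_ /eqP ce].
case/card_gt0P => v; rewrite inE => /andP[vV /existsP[c1 /existsP[c2]]].
case/and5P => v1 v2 b1 b2 /and3P[f1 f2 ne]; apply/imsetP; exists v => //.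
have c12 : #|[set face alpha sigma c1; face alpha sigma c2]| = 2%N by rewrite cards2 ne.
transitivity [set face alpha sigma c1; face alpha sigma c2].
  by apply/esym/eqP; rewrite eqEcard c12 ce subUset !sub1set f1 f2.
apply/eqP; rewrite eqEcard c12 card_ends andbT subUset !sub1set.
by rewrite !imset_f // !inE ?v1 ?v2.
Qed.

Lemma card_vertices_gt0 : planar_map alpha sigma -> (0 < n)%N.
Proof.
(* Without darts the left side of Euler's formula is 0 while the right side is at least 2. *)
move=> pl; case: (posnP n) => // n0; move: card_darts pl; rewrite /planar_map n0 mul0n => D0.
have := max_card (mem (faces alpha sigma)); rewrite D0 leqn0 => /eqP ->.
by rewrite addn2.
Qed.

Lemma dH_le u : (dH alpha sigma col u <= #|Es|)%N.
Proof. by apply: subset_leq_card; apply/subsetP => e; rewrite inE => /andP[]. Qed.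

End FourRegularMap.

(** * Poincare constants and a lower bound on the stationary law *)

Section WormMixing.
Variables (D : finType) (alpha sigma : {perm D}) (col : D -> bool).
Variables (R : realType) (beta : R).
Hypothesis beta_gt1 : 1 < beta.
Local Notation Es := (Estar alpha sigma col).
Local Notation state := (worm_state alpha sigma col).
Local Notation k := (mB alpha sigma col).
Local Notation x := (x_e alpha sigma col beta).
Local Notation q := (worm_q alpha sigma col beta).
Local Notation P := (worm_P alpha sigma col beta).
Local Notation weight := (worm_weight alpha sigma col beta).
Local Notation pi := (worm_pi alpha sigma col beta).
Local Notation bm := (beta_min alpha sigma col beta).
Hypothesis k_gt0 : (0 < k)%N.

Lemma energy_ge0 f : 0 <= energy P pi f.
Proof.
apply: sumr_ge0 => A _; apply: sumr_ge0 => B _.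
case: (eqVneq A B) => [->|ne]; first by rewrite subrr expr0n mulr0.
by apply: mulr_ge0 (sqr_ge0 _);
  exact: mulr_ge0 (pi_ge0 beta_gt1 k_gt0 A) (worm_P_ge0 _ _ _ beta_gt1 ne).
Qed.

Lemma worm_poincare f : inner pi f f - (\sum_A pi A * f A) ^+ 2 <=
  #|Es|%:R * (2 * #|Es|%:R * (k ^ 2)%:R) * energy P pi f.
Proof.
have [before beforeP] := peelings alpha sigma col.
exact: (worm_poincare_with beta_gt1 k_gt0 beforeP (@dH_le _ alpha sigma col)).
Qed.

(* For n = 1 the general bound 4 |E*|^2 k^2 exceeds the required 4 n^6. *)
Lemma worm_poincare_single f : (#|Es| <= 1)%N ->
  inner pi f f - (\sum_A pi A * f A) ^+ 2 <= 2 * energy P pi f.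
Proof.
(* The states are the empty set and at most one {e}. Centring at the empty set leaves only {e},
   which is compared with its direct move to the empty set. *)
move=> E1; apply: (le_trans (variance_le (pi_sum1 beta_gt1 k_gt0) f (f set0))).
rewrite energy_flows // mulr_sumr; apply: ler_sum => A _.
have nneg e : e \in Es -> 0 <= pi A * q A e * (f A - f (sdiff A [set e])) ^+ 2.
  move=> eE; apply: mulr_ge0 (sqr_ge0 _).
  exact: mulr_ge0 (pi_ge0 beta_gt1 k_gt0 A) (q_ge0 beta_gt1 A eE).
have [SA|NS] := boolP (state A); last first.
  by rewrite {1}/worm_pi /worm_weight (negbTE NS) !mul0r mulr_ge0 // sumr_ge0.
have [A0|/set0Pn[e eA]] := eqVneq A set0.
  by rewrite {2}A0 subrr expr0n mulr0 mulr_ge0 // sumr_ge0.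
have AE := state_sub SA; have eE := subsetP AE e eA.
have Ae : A = [set e].
  apply/esym/eqP; rewrite eqEcard sub1set eA cards1.
  exact: leq_trans (subset_leq_card AE) E1.
have ce := Estar_card eE.
have dE u : u \in e -> dH alpha sigma col u = 1%N.
  move=> ue; apply/eqP; rewrite eqn_leq (dg_gt0 eE ue) andbT.
  exact: leq_trans (dH_le _ _ _ _) E1.
rewrite (bigD1 e) //= mulrDr -[leLHS]addr0 lerD //; last first.
  by rewrite mulr_ge0 // sumr_ge0 // => e' /andP[e'E _]; exact: nneg.
(* Both ends of the only edge have degree 1, so the rate is (1 + 1) / 4. *)
have -> : q A e = 2^-1.
  rewrite /worm_q symdE Ae sdiffv set11 !Omega0E bd1 // bd0 -cards_eq0 ce andbF.
  rewrite sub0set eqxx /= (eq_bigr (fun=> 1)) => [|u ue]; last by rewrite dE // invr1.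
  by rewrite sumr_const ce; field.
have -> : sdiff A [set e] = set0 by rewrite Ae sdiffv.
rewrite le_eqVlt; apply/orP; left; apply/eqP.
by move: (f set0) => f0; field.
Qed.

Lemma beta_min_gt1 : 1 < bm.
Proof.
rewrite /beta_min; case: pickP => [e0 e0E|//].
by apply/bigmin_gtP; split=> [|e eE]; apply: beta_e_gt1.
Qed.

Lemma beta_min_le e : e \in Es -> bm <= beta_e alpha sigma col beta e.
Proof.
rewrite /beta_min; case: pickP => [e0 e0E eE|/(_ e) -> //].
exact: bigmin_le_cond.
Qed.

Local Notation xm := ((bm - 1) / (bm + 1)).

Lemma xm_range : 0 < xm < 1.
Proof.
have b1 := beta_min_gt1; have b0 : 0 < bm + 1 by lra.
by rewrite divr_gt0 ?subr_gt0 //= ltr_pdivrMr //; lra.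
Qed.

Lemma xm_le e : e \in Es -> xm <= x e.
Proof.
move=> eE; have b1 := beta_min_gt1; have := beta_min_le eE; rewrite /x_e.
set b := beta_e _ _ _ _ _ => le.
have b0 : 0 < bm + 1 by lra.
have b0' : 0 < b + 1 by lra.
by rewrite ler_pdivrMr // mulrAC ler_pdivlMr //; nra.
Qed.

(** A state weighs at least xm^n, and there are at most 2^n states, each weighing at most 2n. One
    power (xm / 2)^n accounts for xm^n and 2^n, the other absorbs n because n <= 2^n; a factor 2 is
    left over. *)
Lemma pi_lower (n : nat) A : (0 < n)%N -> (k <= 2 * n)%N -> (#|Es| <= n)%N ->
  state A -> (xm / 2) ^+ (2 * n) <= 2 * pi A.
Proof.
move=> n0 kn En SA; have /andP[xm0 xm1] := xm_range.
have AE := state_sub SA.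
have Zg := Z_gt0 beta_gt1 k_gt0.
set Z := \sum_B weight B in Zg.
have r0 : 0 < xm / 2 by rewrite divr_gt0.
have ZU : Z <= (2 * n)%:R * 2 ^+ n.
  apply: (@le_trans _ _ (\sum_(B in powerset Es) (2 * n)%:R)); last first.
    rewrite sumr_const card_powerset -(mulr_natr (2 * n)%:R) ler_wpM2l ?ler0n //.
    by rewrite natrX; apply: ler_weXn2l => //; rewrite ler1n.
  rewrite [leRHS]big_mkcond; apply: ler_sum => B _; rewrite inE /worm_weight.
  case: (boolP (state B)) => [SB|_]; last by case: ifP; rewrite ?ler0n.
  rewrite (state_sub SB); apply: (@le_trans _ _ ((2 * n)%:R * 1)); last by rewrite mulr1.
  apply: ler_pM; rewrite ?(ltW (wt_gt0 beta_gt1 (state_sub SB))) //.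
  - by case: ifP; rewrite ler0n.
  - by case: ifP => _; rewrite ler_nat // leq_pmulr.
  by apply: prodr_ile1 => e /(subsetP (state_sub SB)); exact: x_range_le.
have wA : xm ^+ n <= weight A.
  apply: (@le_trans _ _ (wt x A)).
    apply: (@le_trans _ _ (\prod_(e in A) xm)).
      rewrite prodr_const; apply: ler_wiXn2l; rewrite ?ltW //.
      exact: leq_trans (subset_leq_card AE) En.
    by apply: ler_prod => e /(subsetP AE) eE; rewrite ltW //= xm_le.
  rewrite /worm_weight SA -/(wt x A) ler_peMl ?(ltW (wt_gt0 beta_gt1 AE)) //.
  by case: ifP => _; rewrite ler1n.
have nr : n%:R * (xm / 2) ^+ n <= 1.
  have -> : n%:R * (xm / 2) ^+ n = n%:R / 2 ^+ n * xm ^+ n by rewrite expr_div_n; ring.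
  apply: mulr_ile1; rewrite ?divr_ge0 ?exprn_ge0 ?ler0n ?exprn_ile1 ?(ltW xm0) ?(ltW xm1) //.
  by rewrite ler_pdivrMr ?exprn_gt0 // mul1r -natrX ler_nat ltnW // ltn_expl.
have : xm ^+ n <= 2 * n%:R * 2 ^+ n * pi A.
  apply: (le_trans wA); rewrite /worm_pi -/Z mulrCA ler_peMr ?weight_ge0 //.
  by rewrite ler_pdivlMr // mul1r -natrM.
have -> : (xm / 2) ^+ (2 * n) = (xm / 2) ^+ n / 2 ^+ n * xm ^+ n.
  by rewrite mul2n -addnn exprD {2}exprMn exprVn; ring.
move=> le; have w0 : 0 <= (xm / 2) ^+ n / 2 ^+ n by rewrite divr_ge0 ?exprn_ge0 ?ltW.
apply: (le_trans (ler_wpM2l w0 le)).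
have -> : (xm / 2) ^+ n / 2 ^+ n * (2 * n%:R * 2 ^+ n * pi A) =
  (n%:R * (xm / 2) ^+ n) * (2 * pi A).
  have p2 : 2 ^+ n != 0 :> R by rewrite expf_neq0 // pnatr_eq0.
  by field.
by rewrite ler_piMl // mulr_ge0 ?pi_ge0.
Qed.

End WormMixing.

(** Take t to be the integer part of T. Losing less than one step costs at most exp(2 / C), which is
    at most 2 because exp(-2 / C) >= 1 - 2 / C >= 1/2. *)
Lemma rate_bound (R : realType) (C T a : R) : 4 <= C -> 0 <= T -> T = C * a ->
  exists t : nat, t%:R <= T /\ (1 - C^-1) ^+ (2 * t) <= 2 * expR (- a) ^+ 2.
Proof.
move=> C4 T0 Ta; have C0 : 0 < C by lra.
have /andP[t1 t2] := truncn_itv T0; exists (Num.truncn T); split=> //.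
set t := Num.truncn T in t1 t2 *.
have Ci : C^-1 <= 4^-1 by rewrite lef_pV2 ?posrE //; lra.
have l0 : 0 <= 1 - C^-1 by lra.
have le1 : (1 - C^-1) ^+ (2 * t) <= expR (- C^-1) ^+ (2 * t).
  by apply: lerXn2r; rewrite ?nnegrE ?expR_ge0 // expR_ge1Dx.
apply: (le_trans le1).
rewrite -expRM_natl.
have -> : 2 * expR (- a) ^+ 2 = 2 * expR (- (2 * a)).
  by rewrite -expRM_natl mulrN.
have e2 : expR (2 * C^-1) <= 2.
  have : 2^-1 <= expR (- (2 * C^-1)).
    by apply: le_trans (expR_ge1Dx _); lra.
  rewrite expRN => h; rewrite -[leLHS]invrK -[leRHS]invrK lef_pV2 // ?posrE ?invr_gt0 ?expR_gt0 //.
apply: (@le_trans _ _ (expR (2 * C^-1) * expR (- (2 * a)))); last first.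
  by rewrite ler_wpM2r ?expR_ge0.
rewrite -expRD ler_expR natrM.
have : a <= (t%:R + 1) * C^-1.
  by rewrite ler_pdivlMr // mulrC -Ta -natr1 in t2 *; rewrite ltW.
nra.
Qed.

Theorem theorem8 (R : realType) (D : finType) (alpha sigma : {perm D})
    (col : D -> bool) (beta eps : R) :
  edge_involution alpha ->
  map_connected alpha sigma ->
  planar_map alpha sigma ->
  four_regular sigma ->
  proper_face_coloring alpha sigma col ->
  1 < beta ->
  0 < eps < 1 ->
  let n := #|vertices sigma| in
  let bm := beta_min alpha sigma col beta in
  mixing_time_le (worm_P alpha sigma col beta) (worm_pi alpha sigma col beta)
    (worm_state alpha sigma col) eps
    (4 * n%:R ^+ 7 * (ln (2 / eps) / n%:R + ln (2 * (bm + 1) / (bm - 1)))).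
Proof.
move=> _ _ planar fourR colP beta_gt1 /andP[eps0 eps1] n bm.
have n0 : (0 < n)%N := card_vertices_gt0 fourR planar.
have k0 := card_black_faces_gt0 colP n0.
have kn := card_black_faces_le fourR colP.
have En := card_Estar_le fourR colP.
have b1 : 1 < bm := beta_min_gt1 alpha sigma col beta_gt1.
have n1 : 1 <= n%:R :> R by rewrite ler1n.
set r := (bm - 1) / (bm + 1) / 2.
have r0 : 0 < r by rewrite !divr_gt0 //; lra.
have rE : 2 * (bm + 1) / (bm - 1) = r^-1.
  by rewrite /r; field; rewrite !gt_eqF //; lra.
(* Chosen so that the claimed time is C * a and exp(-a) = (eps / 2) r^n. *)
set a := ln (2 / eps) + n%:R * ln r^-1.
set C : R := 4 * n%:R ^+ 6.
have n6 : 1 <= n%:R ^+ 6 :> R by rewrite exprn_ege1.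
have C4 : 4 <= C by rewrite /C; lra.
have Ta : 4 * n%:R ^+ 7 * (ln (2 / eps) / n%:R + ln (2 * (bm + 1) / (bm - 1))) = C * a.
  rewrite rE /C /a; field; rewrite gt_eqF //; lra.
have a0 : 0 <= a.
  rewrite addr_ge0 ?mulr_ge0 ?ler0n ?ln_ge0 //.
    by rewrite ler_pdivlMr //; lra.
  by rewrite -rE ler_pdivlMr //; lra.
rewrite Ta; have T0 : 0 <= C * a by rewrite mulr_ge0 //; lra.
have [t [tT le]] := rate_bound C4 T0 erefl; exists t; split=> // A SA.
have C1 : 1 < C by lra.
have poincare f : inner (worm_pi alpha sigma col beta) f f -
    (\sum_B worm_pi alpha sigma col beta B * f B) ^+ 2 <=
    C / 2 * energy (worm_P alpha sigma col beta) (worm_pi alpha sigma col beta) f.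
  have [nl|nl] := leqP n 1.
    have EE := energy_ge0 beta_gt1 k0 f.
    apply: (le_trans (worm_poincare_single beta_gt1 k0 f (leq_trans En nl))).
    by rewrite ler_wpM2r //; lra.
  apply: (le_trans (worm_poincare beta_gt1 k0 f)).
  rewrite ler_wpM2r ?energy_ge0 //.
  have -> : C / 2 = (n * (2 * n * n ^ 4))%N%:R.
    by rewrite /C 3!natrM natrX; field.
  rewrite -!natrM ler_nat; apply: leq_mul => //; apply: leq_mul; first exact: leq_mul.
  (* The bound (2n)^2 <= n^4 needs n >= 2, hence the separate case n = 1. *)
  apply: (@leq_trans ((2 * n) ^ 2)%N); first by rewrite leq_exp2r.
  by rewrite expnMn (expnD n 2 2) leq_mul2r (@leq_exp2r 2 n 2) // nl orbT.
have rl := pi_lower beta_gt1 k0 n0 kn En SA.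
set p := worm_pi alpha sigma col beta A in rl.
have p0 : 0 < p.
  have : 0 < r ^+ (2 * n) by rewrite exprn_gt0.
  by rewrite -/bm -/r in rl; lra.
have := tv_decay (worm_P_ge0 alpha sigma col beta_gt1)
  (worm_P_lazy alpha sigma col beta_gt1) (worm_P_sum1 alpha sigma col beta)
  (pi_rev beta_gt1 k0) (pi_ge0 beta_gt1 k0) (pi_sum1 beta_gt1 k0) C1 poincare t p0.
set d := tv_dist _ _ => dec.
have ea : expR (- a) = eps / 2 * r ^+ n.
  have e0 : 0 < 2 / eps by rewrite divr_gt0.
  rewrite /a opprD expRD !expRN expRM_natl !lnK ?posrE ?(invr_gt0 r) //.
  by rewrite invf_div exprVn invrK.
have d0 : 0 <= d by rewrite mulr_ge0 ?invr_ge0 // sumr_ge0.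
suff : (2 * d) ^+ 2 <= eps ^+ 2.
  by rewrite ler_sqr ?nnegrE; lra.
(* The 1/4 in (eps / 2)^2 pays for the factor 2 of [rate_bound] and the factor 2 of [pi_lower]. *)
rewrite -(ler_pM2r p0); apply: (le_trans dec); apply: (le_trans le).
rewrite ea; have -> : 2 * (eps / 2 * r ^+ n) ^+ 2 = eps ^+ 2 / 2 * r ^+ (2 * n).
  by rewrite mulnC exprM; field.
rewrite -/bm -/r in rl; have := sqr_ge0 eps; nra.
Qed.
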